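(* Let $k$ be an algebraically closed field of characteristic $0$, let $K$ be a transcendental extension of $k$ (of arbitrary, possibly infinite, transcendence degree), let $n\geq 2$ be an integer, let $a_1,\ldots,a_n\in K^*$, and let $\Gamma$ be a subgroup of $(K^* )^n$ satisfying $$(k^* )^n\subset\Gamma,\qquad \operatorname{rank}\big(\Gamma/(k^* )^n\big)=r>0 .$$ Then the set of non-degenerate solutions of the equation $$a_1x_1+\cdots+a_nx_n=1\quad\text{in } \mathbf{x}=(x_1,\ldots,x_n)\in\Gamma$$ is contained in the union of not more than $$\sum_{i=2}^{n+1}\binom{i}{2}^r-n+1$$ $(k^* )^n$-cosets.
   Context: $(K^* )^n$ is the $n$-fold direct product of the multiplicative group $K^*$, with coordinatewise multiplication; $\mathbf{x}^m=(x_1^m,\ldots,x_n^m)$ for $m\in\mathbb{Z}$. Rank: if $\Gamma=(k^* )^n$ then $\operatorname{rank}(\Gamma/(k^* )^n)=0$; otherwise $\operatorname{rank}(\Gamma/(k^* )^n)$ is the smallest $r$ for which there are $\mathbf{a}_1,\ldots,\mathbf{a}_r\in\Gamma$ such that for every $\mathbf{x}\in\Gamma$ there are integers $m,z_1,\ldots,z_r$ with $m>0$ and $\xi\in(k^* )^n$ with $\mathbf{x}^m=\xi\cdot\mathbf{a}_1^{z_1}\cdots\mathbf{a}_r^{z_r}$. In particular the rank being equal to $r$ includes that it is finite. A solution $(x_1,\ldots,x_n)$ of $a_1x_1+\cdots+a_nx_n=1$ is non-degenerate if $\sum_{i\in I}a_ix_i\neq 0$ for each proper, non-empty subset $I$ of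 $\{1,\ldots,n\}$. A $(k^* )^n$-coset is a set of the shape $\mathbf{b}\cdot(k^* )^n=\{\mathbf{b}\cdot\xi:\ \xi\in(k^* )^n\}$ with $\mathbf{b}\in\Gamma$. *)

(* Defs.v *)
From HB Require Import structures.
From mathcomp Require Import all_boot all_order all_algebra.
From mathcomp Require Import classical_sets.

Set Implicit Arguments.
Unset Strict Implicit.
Unset Printing Implicit Defensive.

Import GRing.Theory Num.Theory.
Local Open Scope classical_set_scope.
Local Open Scope ring_scope.

(* The n-th power of the multiplicative group of K, inside {ffun 'I_n -> K}.
   The library's ring structure on {ffun 'I_n -> K} is the product ring K^n, so
   its product, 1 and \prod are coordinatewise; since it comes without inverses,
   integer powers are given by [tpow]. *)
Definition torus (K : fieldType) (n : nat) : set {ffun 'I_n -> K} :=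
  [set x | forall i, x i != 0].
Arguments torus : clear implicits.

Definition tpow (K : fieldType) (n : nat) (x : {ffun 'I_n -> K}) (m : int) :
    {ffun 'I_n -> K} :=
  [ffun i => x i ^ m].

Definition is_subgroup (K : fieldType) (n : nat)
    (Gamma : set {ffun 'I_n -> K}) : Prop :=
  [/\ Gamma `<=` torus K n,
      Gamma 1,
      forall x y, Gamma x -> Gamma y -> Gamma (x * y)
    & forall x, Gamma x -> Gamma (tpow x (-1))].

(* K is an extension of k through iota, so [torus k n] embeds in [torus K n]. *)
Definition ktorus (k K : fieldType) (iota : {rmorphism k -> K}) (n : nat) :
    set {ffun 'I_n -> K} :=
  [set [ffun i => iota (xi i)] | xi in torus k n].
Arguments ktorus {k K} iota n.

Definition kcoset (k K : fieldType) (iota : {rmorphism k -> K}) (n : nat)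
    (b : {ffun 'I_n -> K}) : set {ffun 'I_n -> K} :=
  [set b * xi | xi in ktorus iota n].

Definition transcendental_ext (k K : fieldType) (iota : {rmorphism k -> K}) :
    Prop :=
  exists t : K, ~ algebraicOver iota t.

(* r elements of Gamma generate it modulo [ktorus iota n], up to torsion. *)
Definition rank_le (k K : fieldType) (iota : {rmorphism k -> K}) (n : nat)
    (Gamma : set {ffun 'I_n -> K}) (r : nat) : Prop :=
  exists2 a : 'I_r -> {ffun 'I_n -> K}, (forall j, Gamma (a j)) &
    forall x, Gamma x ->
      exists (m : int) (z : 'I_r -> int) (xi : {ffun 'I_n -> K}),
        [/\ 0 < m, ktorus iota n xi
          & tpow x m = xi * \prod_(j < r) tpow (a j) (z j)].

Definition has_rank (k K : fieldType) (iota : {rmorphism k -> K}) (n : nat)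
    (Gamma : set {ffun 'I_n -> K}) (r : nat) : Prop :=
  (Gamma = ktorus iota n /\ r = 0%N) \/
  [/\ Gamma <> ktorus iota n, rank_le iota Gamma r
    & forall s, rank_le iota Gamma s -> (r <= s)%N].

Definition nondegenerate_solution (K : fieldType) (n : nat) (a : 'I_n -> K)
    (x : {ffun 'I_n -> K}) : Prop :=
  \sum_(i < n) a i * x i = 1 /\
  forall I : {set 'I_n}, I != finset.set0 -> I \proper finset.setT ->
    \sum_(i in I) a i * x i != 0.

(* Main.v *)
(** Let [f] be the family [-1, a_1 x_1, ..., a_n x_n], a vanishing sum without
    proper vanishing subsum.  For a derivation [D] of [K] over [k] the
    logarithmic derivative of [x] depends linearly on the rational exponent
    vector [q] of [x] with respect to [r] elements of [Gamma], so words in the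
    derivations act on [f] through polynomials in [q], and the [k]-rank of [f]
    is at most [m] only if all generalized Wronskians of size [m + 1], which
    have degree at most ['C(m + 1, 2)] in [q], vanish.

    A point of rank exactly [m] is a simple zero of these equations: a rational
    tangent direction [u] would, by nondegeneracy, make every
    [sum_j u_j D(g_j) / g_j] exact, that is, give [h], [x] in [K] with
    [D h = h D x] for all [D] and [h] not constant, whereas exponentials of
    nonconstant elements are transcendental over [K].  By a Bezout inequality,
    [N] simple zeros together with one further zero satisfy
    [N + 1 <= 'C(m + 1, 2) ^ r].  Using a solution of lower rank as the further
    zero saves one for every [m] except the smallest rank that occurs, whence
    the term [- n + 1] in the bound. *)

Require Import Defs.
From HB Require Import structures.
From mathcomp Require Import all_boot all_order all_algebra.
From mathcomp Require Import mpoly ring zify.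
From mathcomp Require Import boolp classical_sets.

Set Implicit Arguments.
Unset Strict Implicit.
Unset Printing Implicit Defensive.

Import GRing.Theory Num.Theory.
Local Open Scope classical_set_scope.
Local Open Scope ring_scope.

(** * Derivations *)

(** The points to be counted have rational coordinates, but the minors have coefficients in [K]. The
    simplicity argument only handles a rational direction [u]: its denominators are cleared to form
    an actual product of powers of the [g j] in [K], and independence modulo constants is a
    statement about such products. Hence each minor is split along a basis over the rationals of the
    span of its coefficients, and the Bezout inequality is applied over [rat].

    Since the transcendence degree may be infinite, no basis of derivations is chosen. All
    [k]-derivations are used at once; they are produced by Zorn's lemma, and because [k] is
    algebraically closed their common constants are exactly [k]. This is why the vector [q] of a
    solution determines its coset.

    The zeros being counted need not make up the whole zero set, and the further zero may lie on a
    component of positive dimension. The Bezout inequality is therefore proved by lifting arcs: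
    simple zeros allow Newton lifting, and the arc to be lifted is the image of a line through the
    further zero, so that nothing has to be lifted there. *)

Definition dual (K : fieldType) : Type := (K * K)%type.

Section DualNumbers.
Variable K : fieldType.
Implicit Types x y z : dual K.

HB.instance Definition _ := GRing.Zmodule.copy (dual K) (K * K)%type.

Definition dual_one : dual K := (1, 0).
Definition dual_mul x y : dual K := (x.1 * y.1, x.1 * y.2 + x.2 * y.1).

Fact dual_mulA : associative dual_mul.
Proof.
move=> x y z; rewrite /dual_mul /= mulrA; congr (_, _).
by rewrite mulrDr mulrDl !mulrA addrA.
Qed.

Fact dual_mulC : commutative dual_mul.
Proof.
move=> x y; rewrite /dual_mul mulrC; congr (_, _).
by rewrite addrC [x.2 * _]mulrC [x.1 * _]mulrC.
Qed.

Fact dual_mul1 : left_id dual_one dual_mul.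
Proof. by case=> x y; rewrite /dual_mul /= !mul1r mul0r addr0. Qed.

Fact dual_mulDl : left_distributive dual_mul +%R.
Proof.
by move=> x y z; congr (_, _); rewrite /= !mulrDl // addrACA.
Qed.

Fact dual_one_neq0 : dual_one != 0.
Proof. by apply/eqP => -[/eqP]; rewrite oner_eq0. Qed.

HB.instance Definition _ := GRing.Zmodule_isComNzRing.Build (dual K)
  dual_mulA dual_mulC dual_mul1 dual_mulDl dual_one_neq0.

Definition dual_re x : K := x.1.

Fact dual_re_zmod : zmod_morphism dual_re. Proof. by []. Qed.
Fact dual_re_monoid : monoid_morphism dual_re. Proof. by []. Qed.
HB.instance Definition _ := GRing.isZmodMorphism.Build (dual K) K dual_re
  dual_re_zmod.
HB.instance Definition _ := GRing.isMonoidMorphism.Build (dual K) K dual_re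
  dual_re_monoid.

End DualNumbers.

Section DerivationExtension.
Variable K : fieldType.
Hypothesis charK : [pchar K] =i pred0.
Implicit Types (S : set (dual K)) (x y v : dual K) (P Q : {poly dual K}).

(* A derivation defined on a subring of K is encoded by its graph, a subring of
   the dual numbers K[e] meeting eK trivially. *)
Definition derivation_graph S : Prop :=
  [/\ S 1, forall x y, S x -> S y -> S (x - y),
      forall x y, S x -> S y -> S (x * y)
    & forall x, S x -> x.1 = 0 -> x = 0].

Definition coefs_in S P := forall i, S P`_i.

Lemma graph0 S : derivation_graph S -> S 0.
Proof. by case=> S1 SB _ _; rewrite -(subrr 1); apply: SB. Qed.

Lemma graphD S x y : derivation_graph S -> S x -> S y -> S (x + y).
Proof.
move=> gS Sx Sy; case: (gS) => _ SB _ _; rewrite -[y]opprK; apply: (SB) => //.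
by rewrite -sub0r; apply: SB => //; apply: graph0.
Qed.

Lemma graph_sum S I (r : seq I) (Pr : pred I) (F : I -> dual K) :
  derivation_graph S -> (forall i, S (F i)) -> S (\sum_(i <- r | Pr i) F i).
Proof.
move=> gS SF; elim/big_rec: _ => [|i x _ Sx]; first exact: graph0.
exact: graphD.
Qed.

Lemma coefs_inC S c : derivation_graph S -> S c -> coefs_in S c%:P.
Proof. by move=> gS Sc i; rewrite coefC; case: eqP => // _; apply: graph0. Qed.

Lemma coefs_inX S n : derivation_graph S -> coefs_in S 'X^n.
Proof.
move=> gS i; rewrite coefXn; case: eqP => _; last exact: graph0.
by case: gS.
Qed.

Lemma coefs_inB S P Q :
  derivation_graph S -> coefs_in S P -> coefs_in S Q -> coefs_in S (P - Q).
Proof. by case=> _ SB _ _ SP SQ i; rewrite coefB; apply: SB. Qed.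

Lemma coefs_inM S P Q :
  derivation_graph S -> coefs_in S P -> coefs_in S Q -> coefs_in S (P * Q).
Proof.
move=> gS SP SQ i; rewrite coefM; apply: graph_sum => // j.
by case: gS => _ _ SM _; apply: SM.
Qed.

Lemma coefs_in_deriv S P :
  derivation_graph S -> coefs_in S P -> coefs_in S P^`().
Proof.
move=> gS SP i; rewrite coef_deriv; move: (P`_i.+1) (SP i.+1) => c Sc.
elim: i.+1 => [|m IHm].
  by rewrite mulr0n; apply: graph0.
by rewrite mulrS; apply: graphD.
Qed.

Lemma coefs_in_re0 S P :
  derivation_graph S -> coefs_in S P -> map_poly (@dual_re K) P = 0 -> P = 0.
Proof.
case=> _ _ _ S0 SP P0; apply/polyP => i; rewrite coef0; apply: S0 => //.
by rewrite -[LHS]/(dual_re _) -coef_map P0 coef0.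
Qed.

Lemma horner_re P v :
  (P.[v]).1 = (map_poly (@dual_re K) P).[v.1].
Proof. by rewrite -[LHS]/(dual_re _) -horner_map. Qed.

Lemma horner_dual P (u d : K) :
  P.[(u, d) : dual K] =
  P.[(u, 0) : dual K] + (0, (map_poly (@dual_re K) P)^`().[u] * d).
Proof.
elim/poly_ind: P => [|P c IHP].
  by rewrite !horner0 rmorph0 deriv0 horner0 mul0r add0r.
rewrite !hornerMXaddC {}IHP rmorphD rmorphM /= map_polyX map_polyC /=.
rewrite derivD derivM derivX derivC addr0 mulr1 hornerD hornerMX.
set a := P.[_]; set b := _.[u].
have -> : (map_poly (@dual_re K) P).[u] = a.1 by rewrite horner_re.
rewrite addrAC; congr (_ + _); case: a => a1 a2.
congr (_, _); rewrite /= ?addr0 //.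
by ring.
Qed.

Definition adjoin S v : set (dual K) :=
  [set x | exists2 P, coefs_in S P & x = P.[v]].

Lemma adjoin_graph S v : derivation_graph S ->
  (forall P, coefs_in S P -> (P.[v]).1 = 0 -> P.[v] = 0) ->
  derivation_graph (adjoin S v).
Proof.
move=> gS S0; split.
- exists 1%:P; last by rewrite hornerC.
  by apply: coefs_inC => //; case: gS.
- move=> _ _ [P SP ->] [Q SQ ->]; exists (P - Q); last by rewrite hornerD hornerN.
  exact: coefs_inB.
- move=> _ _ [P SP ->] [Q SQ ->]; exists (P * Q); last by rewrite hornerM.
  exact: coefs_inM.
- by move=> _ [P SP ->]; apply: S0.
Qed.

Lemma sub_adjoin S v : derivation_graph S -> S `<=` adjoin S v.
Proof.
move=> gS x Sx; exists x%:P; last by rewrite hornerC.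
exact: coefs_inC.
Qed.

Lemma mem_adjoin S v : derivation_graph S -> adjoin S v v.
Proof.
by move=> gS; exists 'X; rewrite ?hornerX // -['X]expr1; apply: coefs_inX.
Qed.

Lemma dual_mul_eq0 (c x : dual K) : c.1 != 0 -> c * x = 0 -> x = 0.
Proof.
case: c x => [c1 c2] [x1 x2] /= c0 [] /eqP; rewrite mulf_eq0 (negbTE c0) /=.
move=> /eqP ->; rewrite mulr0 addr0 => /eqP.
by rewrite mulf_eq0 (negbTE c0) => /eqP ->.
Qed.

(** If [u] satisfies no polynomial over [S], its derivative is free and 0 is chosen. Otherwise a
    polynomial of minimal size forces the derivative, and characteristic 0 makes this forced value
    well defined. *)
Lemma adjoin_exists S (u : K) : derivation_graph S ->
  exists2 v, v.1 = u & derivation_graph (adjoin S v).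
Proof.
move=> gS; pose root_of P := coefs_in S P /\ (map_poly (@dual_re K) P).[u] = 0.
have [[P [rP P0]]|nP] := pselect (exists P, root_of P /\ P != 0); last first.
  exists (u, 0) => //; apply: adjoin_graph => // P SP Pu.
  have [->|P0] := eqVneq P 0; first by rewrite horner0.
  by case: nP; exists P; split=> //; split=> //; rewrite -Pu horner_re.
have {P rP P0} [P [[SP Pu] P0 minP]] : exists P : {poly dual K},
    [/\ root_of P, P != 0
      & forall Q, root_of Q -> Q != 0 -> (size P <= size Q)%N].
  pose p n := `[< exists P : {poly dual K}, [/\ root_of P, P != 0 & size P = n] >].
  have exn : exists n, p n by exists (size P); apply/asboolP; exists P.
  case: (ex_minnP exn) => n /asboolP[Q [rQ Q0 sQ]] min; exists Q; split=> //.
  by move=> R rR R0; rewrite sQ; apply: min; apply/asboolP; exists R.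
pose q := map_poly (@dual_re K) P.
have q0 : q != 0 by apply: contra_neq P0; apply: (coefs_in_re0 gS SP).
have sPgt1 : (1 < size P)%N.
  rewrite ltnNge; apply/negP => /size1_polyC eP; move: q0.
  move: Pu; rewrite /q eP map_polyC /= hornerC => ->.
  by rewrite polyC0 eqxx.
(* By minimality the derivative of [P], which is shorter and whose real part vanishes at [u], must
   be 0. Characteristic 0 then kills the real part of the leading coefficient of [P], hence that
   coefficient itself. *)
have dq : q^`().[u] != 0.
  apply/eqP => dqu; have dP : P^`() = 0.
    apply/eqP/negPn/negP => dP0; have := minP P^`().
    rewrite leqNgt lt_size_deriv // => /(_ _ dP0); move=> H; suff: false by [].
    by apply: H; split; [apply: coefs_in_deriv|rewrite -deriv_map].
  have /eqP : (P^`())`_(size P).-2 = 0 by rewrite dP coef0.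
  rewrite coef_deriv; case: (size P) sPgt1 (lead_coefE P) => [|[|n]] //= _ lP.
  rewrite -lP; apply/negP; apply: contraNneq P0 => /(congr1 fst) lP0.
  rewrite -lead_coef_eq0; apply/eqP; case: gS => _ _ _; apply.
    by rewrite lead_coefE; apply: SP.
  move: lP0; rewrite -[LHS]/(dual_re _) raddfMn /= -mulr_natr => /eqP.
  by rewrite mulf_eq0 (pcharf0P K).1 // orbF => /eqP.
(* Implicit differentiation of the equation of [u]: the second coordinate is the only one with
   [P.[v] = 0]. *)
pose v : dual K := (u, - P.[(u, 0)].2 / q^`().[u]).
have Pv : P.[v] = 0.
  rewrite /v horner_dual -/q mulrC divfK //.
  rewrite [X in X + _](surjective_pairing _) horner_re /= Pu.
  by congr (_, _); rewrite /= ?addr0 ?subrr.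
exists v => //; apply: adjoin_graph => // Q SQ Qv.
have {Qv} rQ : root_of Q by split=> //; rewrite -Qv horner_re.
elim: {Q}_.+1 {-2}Q (ltnSn (size Q)) rQ {SQ} => // n IHn Q sQn rQ.
have [->|Q0] := eqVneq Q 0; first by rewrite horner0.
have sPQ := minP _ rQ Q0.
have [SQ Qu] := rQ.
(* Pseudo-division: [S] is only a subring, so [Q] is multiplied by the leading coefficient of [P],
   which is cancelled at the end because its real part is nonzero. *)
pose R := (lead_coef P)%:P * Q - (lead_coef Q)%:P * 'X^(size Q - size P) * P.
have Sl : S (lead_coef P) /\ S (lead_coef Q) by rewrite !lead_coefE.
have SR : coefs_in S R.
  by apply: coefs_inB => //; repeat apply: coefs_inM => //;
    (apply: coefs_inX || apply: coefs_inC) => //; case: Sl.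
have sQ : size Q = (size Q).-1.+1 by rewrite prednK // size_poly_gt0.
have sR : (size R < size Q)%N.
  rewrite [X in (_ < X)%N]sQ ltnS; apply/leq_sizeP => j; rewrite leq_eqVlt.
  rewrite coefB coefCM -mulrA coefCM coefXnM.
  case/predU1P => [<-|ltj].
    have -> : ((size Q).-1 < size Q - size P)%N = false.
      by apply/negbTE; rewrite -leqNgt; lia.
    have -> : ((size Q).-1 - (size Q - size P) = (size P).-1)%N by lia.
    by rewrite -!lead_coefE mulrC subrr.
  have -> : (j < size Q - size P)%N = false by lia.
  have /leq_sizeP -> // : (size Q <= j)%N by lia.
  have /leq_sizeP -> // : (size P <= j - (size Q - size P))%N by lia.
  by rewrite !mulr0 subrr.
have Rv : R.[v] = 0.
  apply: IHn; first by lia.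
  split=> //; rewrite /R !(rmorphB, rmorphM) /= hornerD hornerN !hornerM.
  by rewrite Qu Pu !mulr0 subrr.
move: Rv; rewrite /R hornerD hornerN !hornerM Pv mulr0 subr0 hornerC.
apply: dual_mul_eq0; apply: contra_neq P0 => lP.
by apply/eqP; rewrite -lead_coef_eq0; apply/eqP; case: gS => _ _ _; apply;
  case: Sl.
Qed.

Lemma derivation_extend (S0 : set (dual K)) : derivation_graph S0 ->
  exists D : K -> K, [/\ {morph D : x y / (x : K) - y},
    forall x y : K, D (x * y) = D x * y + x * D y & forall x : dual K, S0 x -> D x.1 = x.2].
Proof.
(* Zorn's lemma is applied to what is added to [S0], so that the empty chain is covered too. *)
move=> gS0; pose good (X : set (dual K)) := derivation_graph (X `|` S0).
have [F goodF totF|A [gA maxA]] := @Zorn_bigcup _ good.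
  pose U := \bigcup_(X in F) X `|` S0.
  have sub2 x y : U x -> U y ->
      exists Z, [/\ derivation_graph Z, Z `<=` U, Z x & Z y].
    have FU X : F X -> X `|` S0 `<=` U.
      by move=> FX z [Xz|]; [left; exists X|right].
    case=> [[X FX Xx]|S0x] [[Y FY Yy]|S0y].
    - have [XY|YX] := totF _ _ FX FY.
      + exists (Y `|` S0); split; [exact: goodF|exact: FU|left; exact: XY|].
        by left.
      + exists (X `|` S0); split; [exact: goodF|exact: FU|by left|].
        by left; exact: YX.
    - by exists (X `|` S0); split; [exact: goodF|exact: FU|left|right].
    - by exists (Y `|` S0); split; [exact: goodF|exact: FU|right|left].
    - by exists S0; split=> // z S0z; right.
  split.
  - by right; case: gS0.
  - move=> x y Ux Uy; have [Z [[_ ZB _ _] ZU Zx Zy]] := sub2 _ _ Ux Uy.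
    by apply/ZU/ZB.
  - move=> x y Ux Uy; have [Z [[_ _ ZM _] ZU Zx Zy]] := sub2 _ _ Ux Uy.
    by apply/ZU/ZM.
  - move=> x Ux; have [Z [[_ _ _ Z0] _ Zx _]] := sub2 _ _ Ux Ux.
    exact: Z0.
pose S := A `|` S0.
have totS u : exists w, S (u, w).
  have [v vu gv] := adjoin_exists u gA; exists v.2.
  rewrite -vu -surjective_pairing; apply: contrapT => nSv.
  apply: (maxA (adjoin S v)).
    split; first by move=> x Ax; apply: sub_adjoin => //; left.
    by move=> /(_ v (mem_adjoin _ gA)) Av; apply: nSv; left.
  rewrite /good (_ : _ `|` _ = adjoin S v) //; apply/seteqP; split=> x.
    by case=> // S0x; apply: sub_adjoin => //; right.
  by left.
have [D SD] := choice totS.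
case: gA => S1 SB SM S0'.
have uniqS u w : S (u, w) -> D u = w.
  move=> Sw; have := S0' _ (SB _ _ (SD u) Sw); rewrite /= subrr => /(_ erefl).
  by move=> /(congr1 snd) /= /eqP; rewrite subr_eq0 => /eqP.
exists D; split.
- by move=> x y; apply: uniqS; apply: SB (SD x) (SD y).
- by move=> x y; apply: uniqS; rewrite addrC; apply: SM (SD x) (SD y).
- by move=> x S0x; apply: uniqS; right; rewrite -surjective_pairing.
Qed.

(** Differentiation of polynomials in [t] is well defined on values by the hypothesis, and it
    extends to [K]. The ground ring is arbitrary so as to cover both [k] and [k[x]], the latter
    giving derivations that kill [x]. *)
Lemma derivation_transcendental (R : comNzRingType) (rho : {rmorphism R -> K})
    (t : K) :
  (forall P : {poly R}, (map_poly rho P).[t] = 0 -> map_poly rho P = 0) ->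
  exists D : K -> K, [/\ {morph D : x y / (x : K) - y},
    forall x y : K, D (x * y) = D x * y + x * D y, forall c, D (rho c) = 0
    & D t = 1].
Proof.
move=> t_tr; pose phi (P : {poly R}) : dual K :=
  ((map_poly rho P).[t], (map_poly rho P)^`().[t]).
have [|D [DB DM Dphi]] := @derivation_extend (range phi).
- split.
  + by exists 1 => //; rewrite /phi rmorph1 hornerC derivC horner0.
  + move=> _ _ [P _ <-] [Q _ <-]; exists (P - Q) => //.
    by rewrite /phi rmorphB derivB !hornerD !hornerN.
  + move=> _ _ [P _ <-] [Q _ <-]; exists (P * Q) => //.
    rewrite /phi rmorphM derivM hornerD !hornerM; congr (_, _) => /=.
    by rewrite addrC.
  + by move=> _ [P _ <-] /t_tr P0; rewrite /phi P0 deriv0 horner0.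
- exists D; split=> // [c|].
    have /Dphi : range phi (phi c%:P) by exists c%:P.
    by rewrite /phi map_polyC /= hornerC derivC horner0.
  have /Dphi : range phi (phi 'X) by exists 'X.
  by rewrite /phi map_polyX /= hornerX derivX hornerC.
Qed.

End DerivationExtension.

Record derivation (k K : fieldType) (iota : {rmorphism k -> K}) := Derivation {
  derivation_fun :> K -> K;
  _ : {morph derivation_fun : x y / x - y};
  _ : forall x y, derivation_fun (x * y) = derivation_fun x * y + x * derivation_fun y;
  _ : forall c, derivation_fun (iota c) = 0 }.

Section Derivations.
Variables (k K : fieldType) (iota : {rmorphism k -> K}).
Implicit Types (D : derivation iota) (x y : K).

Fact derivation_zmod D : zmod_morphism D. Proof. by case: D. Qed.
HB.instance Definition _ D := GRing.isZmodMorphism.Build K K D (derivation_zmod D).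

Lemma derM D x y : D (x * y) = D x * y + x * D y. Proof. by case: D. Qed.

Lemma derC D c : D (iota c) = 0. Proof. by case: D. Qed.

Lemma derZ D c x : D (iota c * x) = iota c * D x.
Proof. by rewrite derM derC mul0r add0r. Qed.

Lemma der1 D : D 1 = 0. Proof. by rewrite -(rmorph1 iota) derC. Qed.

Lemma der_horner D (p : {poly k}) x :
  D (map_poly iota p).[x] = (map_poly iota p^`()).[x] * D x.
Proof.
elim/poly_ind: p => [|p c IHp]; first by rewrite deriv0 !rmorph0 !horner0 raddf0 mul0r.
rewrite derivD derivM derivX derivC addr0 mulr1 !(rmorphD, rmorphM) /=.
rewrite map_polyX map_polyC /= !hornerE raddfD /= derC addr0 derM IHp.
by ring.
Qed.

Definition logder D x := D x / x.

Lemma logderM D x y : x != 0 -> y != 0 -> logder D (x * y) = logder D x + logder D y.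
Proof. by move=> x0 y0; rewrite /logder derM; field; apply/andP. Qed.

Lemma logderV D x : x != 0 -> logder D x^-1 = - logder D x.
Proof.
move=> x0; apply/eqP; rewrite -addr_eq0 -logderM ?invr_neq0 // mulVf //.
by rewrite /logder der1 mul0r.
Qed.

Lemma logderXn D x n : x != 0 -> logder D (x ^+ n) = logder D x *+ n.
Proof.
move=> x0; elim: n => [|n IHn]; first by rewrite /logder der1 mul0r mulr0n.
by rewrite exprS logderM ?expf_neq0 // IHn mulrS.
Qed.

Lemma logderXz D x (z : int) : x != 0 -> logder D (x ^ z) = logder D x *~ z.
Proof.
move=> x0; case: z => n; first by rewrite -exprnP logderXn.
by rewrite NegzE -exprnN logderV ?expf_neq0 // logderXn // mulrNz.
Qed.

Lemma logder_prod D I (r : seq I) (P : pred I) (F : I -> K) :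
  (forall i, F i != 0) ->
  logder D (\prod_(i <- r | P i) F i) = \sum_(i <- r | P i) logder D (F i).
Proof.
move=> F0; elim: r => [|i r IHr]; first by rewrite !big_nil /logder der1 mul0r.
rewrite !big_cons; case: ifP => // _; rewrite logderM // ?IHr //.
by elim/big_rec: _ => [|j x _ x0]; [apply: oner_neq0 | apply: mulf_neq0].
Qed.

Lemma logderC D c : logder D (iota c) = 0.
Proof. by rewrite /logder derC mul0r. Qed.

End Derivations.

(** * Constants of all derivations, and transcendence of exponentials *)

Section ClosedConstants.
Variables (k : closedFieldType) (K : fieldType) (iota : {rmorphism k -> K}).
Hypothesis charK : [pchar K] =i pred0.

Definition constant : set K := range iota.

Lemma root_constant (p : {poly k}) x :
  p != 0 -> (map_poly iota p).[x] = 0 -> constant x.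
Proof.
have [rs ->] := closed_field_poly_normal p; rewrite scale_poly_eq0 negb_or.
case/andP=> l0 _; rewrite map_polyZ rmorph_prod hornerZ => /eqP.
rewrite mulf_eq0 fmorph_eq0 (negbTE l0) horner_prod prodf_seq_eq0 /=.
case/hasP=> z _ /=; rewrite rmorphB /= map_polyX map_polyC hornerXsubC.
by rewrite subr_eq0 => /eqP ->; exists z.
Qed.

Lemma derivation_nonconstant x :
  ~ constant x -> exists D : derivation iota, D x = 1.
Proof.
move=> ncx; have [P Px|D [DB DM Dc Dx]] :=
  @derivation_transcendental _ charK _ iota x.
  have [->|P0] := eqVneq P 0; first by rewrite rmorph0.
  by case: ncx; apply: root_constant P0 Px.
by exists (Derivation DB DM Dc).
Qed.

(** An element outside the algebraically closed field [k] is transcendental over it, so some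
    derivation takes the value 1 there. *)
Lemma der0_constant x : (forall D : derivation iota, D x = 0) -> constant x.
Proof.
move=> D0; apply: contrapT => /derivation_nonconstant[D Dx].
by have := D0 D; rewrite Dx => /eqP; rewrite oner_eq0.
Qed.

Definition horner_at (x : K) : {rmorphism {poly k} -> K} :=
  horner_eval x \o map_poly iota.

Definition horner2 (x y : K) (P : {poly {poly k}}) : K :=
  (map_poly (horner_at x) P).[y].

Lemma horner2D x y P Q : horner2 x y (P + Q) = horner2 x y P + horner2 x y Q.
Proof. by rewrite /horner2 rmorphD hornerD. Qed.

Lemma horner2M x y P Q : horner2 x y (P * Q) = horner2 x y P * horner2 x y Q.
Proof. by rewrite /horner2 rmorphM hornerM. Qed.

Lemma horner2C x y c : horner2 x y c%:P = horner_at x c.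
Proof. by rewrite /horner2 map_polyC hornerC. Qed.

Lemma horner2X x y : horner2 x y 'X = y.
Proof. by rewrite /horner2 map_polyX hornerX. Qed.

Lemma horner_atE x p : horner_at x p = (map_poly iota p).[x]. Proof. by []. Qed.

(** With [y] behaving as the exponential of [x], the derivation acts on polynomials as the vector
    field d/dX + Y d/dY. *)
Lemma der_horner2 (D : derivation iota) x y P : D x = 1 -> D y = y ->
  D (horner2 x y P) = horner2 x y (map_poly (@deriv _) P + P^`() * 'X).
Proof.
move=> Dx Dy; have Dev p : D (horner_at x p) = horner_at x p^`().
  by rewrite !horner_atE der_horner Dx mulr1.
elim/poly_ind: P => [|P c IHP].
  by rewrite deriv0 mul0r raddf0 addr0 -polyC0 horner2C !raddf0.
have -> : map_poly (@deriv _) (P * 'X + c%:P) =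
    map_poly (@deriv _) P * 'X + (c^`())%:P.
  apply/polyP => i; rewrite coef_map !coefD !coefMX !coefC coef_map.
  by case: i => [|i] /=; rewrite ?add0r // !addr0.
rewrite derivD derivM derivX derivC addr0 mulr1.
move: IHP; rewrite !(horner2D, horner2M, horner2C, horner2X) => IHP.
by rewrite raddfD /= Dev derM IHP Dy; ring.
Qed.

(** Differentiation lowers degrees, so the left side is shorter than [p * q], whereas in
    characteristic 0 the right side is not. Equality would make [q / p] a rational function whose
    logarithmic derivative is a positive integer. *)
Lemma wronskian_size (p q : {poly k}) m : p != 0 -> q != 0 ->
  p * q^`() - p^`() * q <> (p * q) *+ m.+1.
Proof.
move=> p0 q0 /(congr1 (fun r : {poly k} => size r)).
have chk : [pchar k] =i pred0 by move=> c; rewrite -(fmorph_pchar iota) charK.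
have -> : size ((p * q) *+ m.+1) = size (p * q).
  by rewrite -scaler_nat size_scale // (pcharf0P k).1.
move=> es; have: (size (p * q^`() - p^`() * q)%R < size (p * q)%R)%N.
  have sp : (0 < size p)%N by rewrite size_poly_gt0.
  have sq : (0 < size q)%N by rewrite size_poly_gt0.
  have lp := lt_size_deriv p0; have lq := lt_size_deriv q0.
  rewrite (leq_ltn_trans (size_polyD _ _)) // size_polyN gtn_max [size (p * q)]size_mul //.
  have aux a b c : (0 < a -> c < b -> (a + c).-1 < (a + b).-1)%N by lia.
  apply/andP; split; apply: leq_ltn_trans (size_polyMleq _ _) _.
    exact: aux.
  by rewrite addnC [(size p + _)%N]addnC; apply: aux.
by rewrite es ltnn.
Qed.

(* The hypothesis says that h behaves as the exponential of x. *)
Lemma exp_constant (h x : K) : h != 0 ->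
  (forall D : derivation iota, D h = h * D x) -> constant h.
Proof.
move=> h0 Dh; apply: contrapT => nch.
have ncx : ~ constant x.
  move=> [c _ ex]; apply: nch; apply: der0_constant => D.
  by rewrite Dh -ex derC mulr0.
(* If [h] is transcendental over [k(x)], some derivation kills [x] but maps [h] to 1, against the
   hypothesis. Otherwise a relation of minimal degree in [h] is studied. *)
have [[P0 [P0nz P0h]]|nP] := pselect (exists P, P != 0 /\ horner2 x h P = 0); last first.
  have [P Ph|D [DB DM Dc Dhh]] :=
    @derivation_transcendental _ charK _ (horner_at x) h.
    have [->|P0] := eqVneq P 0; first by rewrite rmorph0.
    by case: nP; exists P.
  have DcC c : D (iota c) = 0.
    by have := Dc c%:P; rewrite horner_atE map_polyC hornerC.
  have := Dh (Derivation DB DM DcC); rewrite /= Dhh.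
  have := Dc 'X; rewrite horner_atE map_polyX hornerX => ->.
  by rewrite mulr0 => /eqP; rewrite oner_eq0.
pose good n := `[< exists P : {poly {poly k}}, [/\ P != 0, horner2 x h P = 0 & size P = n] >].
have exn : exists n, good n by exists (size P0); apply/asboolP; exists P0.
case: (ex_minnP exn) => n /asboolP[P [Pnz Ph sP]] min {P0 P0nz P0h exn}.
have {}min (Q : {poly {poly k}}) : (size Q < n)%N -> horner2 x h Q = 0 -> Q = 0.
  move=> sQ Qh; have [//|Q0] := eqVneq Q 0; move: sQ; rewrite ltnNge.
  by rewrite min //; apply/asboolP; exists Q.
have [D Dx] := derivation_nonconstant ncx.
have Dhh : D h = h by rewrite Dh Dx mulr1.
pose P' := map_poly (@deriv _) P + P^`() * 'X.
have P'i i : P'`_i = (P`_i)^`() + P`_i *+ i.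
  rewrite /P' coefD coef_map coefMX coef_deriv.
  by case: i => [|i] //=; rewrite mulr0n.
have P'h : horner2 x h P' = 0 by rewrite -(der_horner2 _ Dx Dhh) Ph raddf0.
pose e := n.-1; pose A := P`_e.
have A0 : A != 0 by rewrite /A /e -sP -lead_coefE lead_coef_eq0.
have n0 : (0 < n)%N by rewrite -sP size_poly_gt0.
(* The relation and its derivative are combined so that the top coefficient cancels; minimality
   makes the result zero. *)
pose R := A *: P' - P'`_e *: P.
have R0 : R = 0.
  apply: min.
    rewrite -(prednK n0) ltnS; apply/leq_sizeP => j.
    rewrite leq_eqVlt coefB !coefZ => /predU1P[<-|ltj].
      by rewrite mulrC subrr.
    have Pj : P`_j = 0 by rewrite nth_default // sP -(prednK n0).
    by rewrite (P'i j) Pj mul0rn raddf0 addr0 !mulr0 subrr.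
  move: Ph P'h; rewrite /horner2 /R !rmorphB /= !map_polyZ hornerD hornerN.
  by rewrite !hornerZ => -> ->; rewrite !mulr0 subrr.
(* The coefficient of index [i] in [R] is the difference of the two sides excluded by
   [wronskian_size], with multiplier [e - i]. So the minimal relation is a monomial in [h], and its
   coefficient would make [x] algebraic. *)
have Pi0 i : (i < e)%N -> P`_i = 0.
  move=> lti; apply/eqP/negPn/negP => Pi.
  have := congr1 (fun Q : {poly {poly k}} => Q`_i) R0.
  rewrite /R coefB !coefZ !P'i coef0 -/A => eR.
  apply: (wronskian_size (m := (e - i).-1) A0 Pi); rewrite prednK ?subn_gt0 //.
  apply/eqP; rewrite -subr_eq0; apply/eqP; rewrite -[RHS]eR mulrnBr ?(ltnW lti) //.
  rewrite mulrDr mulrDl mulrnAr mulrnAl opprB opprD !addrA.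
  by congr (_ - _); rewrite addrAC.
have eP : P = A *: 'X^e.
  apply/polyP => i; rewrite coefZ coefXn; case: (ltngtP i e) => [/Pi0 ->|lti|->].
  - by rewrite mulr0.
  - by rewrite mulr0 nth_default // sP -(prednK n0).
  - by rewrite mulr1.
move/eqP: Ph; rewrite /horner2 eP map_polyZ map_polyXn hornerZ hornerXn.
rewrite mulf_eq0 expf_eq0 (negbTE h0) andbF orbF /= => /eqP Ax.
by apply: ncx; apply: root_constant A0 Ax.
Qed.

End ClosedConstants.

(** * A Bezout inequality for simple zeros *)

Section MonomialCount.
Variable r : nat.

Lemma leq_mdeg (m : 'X_{1..r}) i : (m i <= mdeg m)%N.
Proof. by rewrite mdegE (bigD1 i) //= leq_addr. Qed.

Lemma card_bmnm_le b : (#|{: 'X_{1..r < b.+1}}| <= b.+1 ^ r)%N.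
Proof.
pose f (m : 'X_{1..r < b.+1}) : {ffun 'I_r -> 'I_b.+1} := [ffun i => inord (m i)].
have f_inj : injective f.
  move=> m1 m2 /ffunP ef; apply/val_inj/mnmP => i.
  have := congr1 val (ef i); rewrite !ffunE /= !inordK //.
    by apply: leq_ltn_trans (leq_mdeg _ _) (bmdeg _).
  by apply: leq_ltn_trans (leq_mdeg _ _) (bmdeg _).
by have := leq_card f f_inj; rewrite card_ffun !card_ord.
Qed.

(** Euclidean division of each exponent by [d]: the remainders take [d ^ r] values and the quotient
    monomial has degree at most [J + N]. *)
Lemma card_bmnm_div d J N : (0 < d)%N ->
  (#|{: 'X_{1..r < (d * J + N).+1}}| <= d ^ r * #|{: 'X_{1..r < (J + N).+1}}|)%N.
Proof.
case: d => // d _.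
pose quo (m : 'X_{1..r}) : 'X_{1..r} := [multinom (m i %/ d.+1)%N | i < r].
have quo_lt (m : 'X_{1..r < (d.+1 * J + N).+1}) : (mdeg (quo m) < (J + N).+1)%N.
  have := bmdeg m; rewrite !ltnS => mlt.
  have : (mdeg (quo m) * d.+1 <= mdeg m)%N.
    rewrite !mdegE big_distrl /=; apply: leq_sum => i _.
    by rewrite mnmE leq_divM.
  by move=> h; rewrite -(leq_pmul2r (ltn0Sn d)); apply: leq_trans h (leq_trans mlt _); nia.
pose f (m : 'X_{1..r < (d.+1 * J + N).+1}) :
    {ffun 'I_r -> 'I_d.+1} * 'X_{1..r < (J + N).+1} :=
  ([ffun i => inord (m i %% d.+1)], BMultinom (quo_lt m)).
have f_inj : injective f.
  move=> m1 m2 ef; apply/val_inj/mnmP => i.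
  have e1 := congr1 (fun z : _ * _ => fun_of_fin z.1 i) ef.
  have e2 := congr1 (fun z : _ * 'X_{1..r < _} => (val z.2 : 'X_{1..r}) i) ef.
  have := congr1 val e1; rewrite !ffunE /= !inordK ?ltn_mod // => e1i.
  move: e2; rewrite /= !mnmE => e2i.
  by rewrite (divn_eq (m1 i) d.+1) e1i e2i -divn_eq.
by have := leq_card f f_inj; rewrite card_prod card_ffun !card_ord.
Qed.

Lemma exp_beats_poly D N : (0 < D)%N ->
  exists t, (D ^ t * (1 + t * N) ^ r < D.+1 ^ t)%N.
Proof.
(* Bernoulli's inequality gives [(1 + 1/D) ^ u >= 1 + E ^ r] for [u = D * E ^ r]. With
   [t = r.+1 * u], the choice of [E] gives [1 + t * N <= E * (1 + E ^ r)], whose [r]-th power is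
   below [(1 + E ^ r) ^ r.+1]. *)
move=> D0; pose E := (1 + r.+1 * D * N)%N; have [u eu] : exists u, u = (D * E ^ r)%N by eexists.
have bernoulli n : (D ^ n * (D + n) <= D * D.+1 ^ n)%N.
  elim: n => [|n IHn]; first by rewrite !expn0 addn0 mul1n muln1.
  rewrite expnS -mulnA [(D.+1 ^ _)%N]expnS.
  apply: (@leq_trans (D.+1 * (D ^ n * (D + n)))%N).
    rewrite !(mulnCA _ (D ^ n)%N) leq_mul2l; apply/orP; right; nia.
  by rewrite [leqRHS]mulnCA leq_mul2l IHn orbT.
exists (r.+1 * u)%N.
have lb : (D ^ (r.+1 * u) * (1 + E ^ r) ^ r.+1 <= D.+1 ^ (r.+1 * u))%N.
  have Dr : (0 < D ^ r.+1)%N by rewrite expn_gt0 D0.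
  rewrite -(leq_pmul2l Dr) [(r.+1 * u)%N]mulnC !expnM -!expnMn leq_exp2r //.
  have := bernoulli u; rewrite {2}eu -{2}[D]muln1 -mulnDr.
  by rewrite mulnCA.
apply: leq_trans lb; rewrite ltn_pmul2l ?expn_gt0 ?D0 //.
have ub : (1 + r.+1 * u * N <= E * (1 + E ^ r))%N.
  rewrite eu /E; nia.
apply: leq_ltn_trans (_ : (E * (1 + E ^ r)) ^ r < _)%N.
  by case: (r) ub => // r' ub; rewrite leq_exp2r.
by rewrite expnMn expnS ltn_pmul2r ?add1n // expn_gt0.
Qed.

(** If this failed for every [J], then with [D = d ^ r] the number of monomials would grow by a
    factor [D.+1 / D] whenever the degree bound grows by [N]. That is exponential growth, against
    the bound [card_bmnm_le]. *)
Lemma monomial_count d N : (0 < d)%N -> (d ^ r <= N)%N ->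
  exists J, (#|{: 'X_{1..r < (d * J + N).+1}}|
             < N.+1 * #|{: 'X_{1..r < J.+1}}|)%N.
Proof.
move=> d0 drN; apply: contrapT => nJ; pose D := (d ^ r)%N.
have D0 : (0 < D)%N by rewrite expn_gt0 d0.
have step J : (D.+1 * #|{: 'X_{1..r < J.+1}}|
    <= D * #|{: 'X_{1..r < (J + N).+1}}|)%N.
  rewrite leqNgt; apply/negP => lt; apply: nJ; exists J.
  apply: leq_ltn_trans (card_bmnm_div J N d0) _; apply: leq_trans lt _.
  by rewrite leq_mul2r ltnS drN orbT.
have [t] := exp_beats_poly N D0; rewrite ltnNge => /negP; apply.
have iter_step : (D.+1 ^ t <= D ^ t * #|{: 'X_{1..r < (t * N).+1}}|)%N.
  elim: t => [|t IHt].
    rewrite !expn0 mul0n mul1n; apply/card_gt0P.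
    by exists (bm0 : 'X_{1..r < 1}).
  have := leq_mul (leqnn D.+1) IHt; rewrite -expnS => h; apply: leq_trans h _.
  rewrite mulnCA expnSr -mulnA leq_mul2l; apply/orP; right.
  by have := step (t * N)%N; rewrite -mulSnr.
apply: leq_trans iter_step _; rewrite leq_mul2l; apply/orP; right.
by rewrite add1n; apply: card_bmnm_le.
Qed.

End MonomialCount.

(** * Taylor expansion and evaluation of polynomials along arcs *)

Section Taylor.
Variables (n : nat) (R S : comNzRingType) (f : {rmorphism R -> S}).

Lemma mpoly_rect_closed (T : {mpoly R[n]} -> Prop) :
  (forall c, T c%:MP) -> (forall i, T 'X_i) ->
  (forall p q, T p -> T q -> T (p + q)) ->
  (forall p q, T p -> T q -> T (p * q)) -> forall p, T p.
Proof.
move=> TC TX TD TM; elim/mpolyind => [|c m p _ _ Tp]; first by rewrite -mpolyC0.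
apply: (TD) => //; rewrite -mul_mpolyC; apply: (TM) => //.
rewrite mpolyXE_id; elim/big_rec: _ => [|i q _ Tq]; first by rewrite -mpolyC1.
apply: (TM) => //; elim: (m i) => [|e IHe]; first by rewrite expr0 -mpolyC1.
by rewrite exprS; apply: TM.
Qed.

Lemma mmap_taylor (x y : 'I_n -> S) (c : S) (p : {mpoly R[n]}) :
  exists e, mmap f (fun j => x j + c * y j) p =
    mmap f x p + c * (\sum_j mmap f x p^`M(j) * y j) + c ^+ 2 * e.
Proof.
elim/mpoly_rect_closed: p => [a|i|p q [e1 e1P] [e2 e2P]|p q [e1 e1P] [e2 e2P]].
- exists 0; rewrite !mmapC big1 ?mulr0 ?addr0 // => j _.
  by rewrite mderivC mmap0 mul0r.
- exists 0; rewrite !mmapX !mmap1U mulr0 addr0; congr (_ + c * _).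
  rewrite (bigD1 i) //= big1 ?addr0 => [|j ji].
    rewrite mderivX mnm1E eqxx scale1r.
    have -> : (U_(i) - U_(i) = 0 :> 'X_{1..n})%MM.
      by apply/mnmP => j; rewrite mnmBE subnn mnm0E.
    by rewrite mpolyX0 rmorph1 mul1r.
  by rewrite mderivX mnm1E eq_sym (negbTE ji) scale0r mmap0 mul0r.
- exists (e1 + e2); rewrite !mmapD e1P e2P.
  have -> : \sum_j mmap f x (p + q)^`M(j) * y j =
      \sum_j mmap f x p^`M(j) * y j + \sum_j mmap f x q^`M(j) * y j.
    rewrite -big_split; apply: eq_bigr => j _ /=.
    by rewrite mderivD mmapD mulrDl.
  by ring.
- rewrite !rmorphM /= e1P e2P.
  have -> : \sum_j mmap f x (p * q)^`M(j) * y j =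
      (\sum_j mmap f x p^`M(j) * y j) * mmap f x q
      + mmap f x p * \sum_j mmap f x q^`M(j) * y j.
    rewrite mulr_suml mulr_sumr -big_split; apply: eq_bigr => j _ /=.
    by rewrite mderivM mmapD !rmorphM /=; ring.
  set P := mmap f x p; set Q := mmap f x q.
  set dP := \sum_j _; set dQ := \sum_j _.
  exists (P * e2 + Q * e1 + dP * dQ + c * (dP * e2 + dQ * e1) + c ^+ 2 * e1 * e2).
  by ring.
Qed.

Lemma mmap_congr (x y : 'I_n -> S) (c : S) (p : {mpoly R[n]}) :
  (forall j, exists g, x j - y j = c * g) ->
  exists g, mmap f x p - mmap f y p = c * g.
Proof.
move=> /choice[g xy]; have [e eP] := mmap_taylor y g c p.
exists (\sum_j mmap f y p^`M(j) * g j + c * e); rewrite mulrDr mulrA -expr2.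
have -> : mmap f x p = mmap f (fun j => y j + c * g j) p; last first.
  by rewrite eP; ring.
by rewrite /mmap; apply: eq_bigr => m _; congr (_ * _); apply: mmap1_eq => j;
  rewrite -xy addrC subrK.
Qed.

End Taylor.

Section MpolyEval.
Variables (n : nat) (F : fieldType).
Implicit Types (p : {mpoly F[n]}) (x : 'I_n -> {poly F}) (v : 'I_n -> F).

Definition grad_along (u v : 'I_n -> F) p : F := \sum_j u j * p^`M(j).@[v].

Definition meval_poly x p : {poly F} := mmap (@polyC F) x p.

Lemma meval_polyD x p q : meval_poly x (p + q) = meval_poly x p + meval_poly x q.
Proof. exact: rmorphD. Qed.

Lemma meval_polyM x p q : meval_poly x (p * q) = meval_poly x p * meval_poly x q.
Proof. exact: rmorphM. Qed.

Lemma meval_polyXn x p e : meval_poly x (p ^+ e) = meval_poly x p ^+ e.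
Proof. exact: rmorphXn. Qed.

Lemma meval_poly0 x : meval_poly x 0 = 0.
Proof. exact: raddf0. Qed.

Lemma meval_poly_sum x (I : Type) (s : seq I) (P : pred I) (G : I -> {mpoly F[n]}) :
  meval_poly x (\sum_(i <- s | P i) G i) = \sum_(i <- s | P i) meval_poly x (G i).
Proof. exact: raddf_sum. Qed.

Lemma horner_meval_poly x p (s : F) :
  (meval_poly x p).[s] = p.@[fun j => (x j).[s]].
Proof.
elim/mpoly_rect_closed: p => [a|i|p q ep eq|p q ep eq].
- by rewrite /meval_poly mmapC hornerC mevalC.
- by rewrite /meval_poly mmapX mmap1U mevalXU.
- by rewrite /meval_poly !rmorphD hornerD; congr (_ + _).
- by rewrite /meval_poly !rmorphM hornerM; congr (_ * _).
Qed.

Lemma meval_poly_line v w p : exists e, meval_poly (fun j => (v j)%:P + 'X * (w j)%:P) p =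
  (p.@[v])%:P + 'X * (grad_along w v p)%:P + 'X ^+ 2 * e.
Proof.
have mvC q : mmap (@polyC F) (fun j => (v j)%:P) q = (q.@[v])%:P.
  elim/mpoly_rect_closed: q => [a|i|q1 q2 e1 e2|q1 q2 e1 e2].
  - by rewrite mmapC mevalC.
  - by rewrite mmapX mmap1U mevalXU.
  - by rewrite !rmorphD /= e1 e2.
  - by rewrite !rmorphM /= e1 e2.
have [e eP] := @mmap_taylor n _ _ (@polyC F) (fun j => (v j)%:P)
  (fun j => (w j)%:P) 'X p.
exists e; rewrite /meval_poly eP mvC; congr (_ + 'X * _ + _).
by rewrite rmorph_sum; apply: eq_bigr => j _; rewrite mvC rmorphM /= mulrC.
Qed.

Lemma msize_leP p k :
  (forall m : 'X_{1..n}, (k <= mdeg m)%N -> p@_m = 0) -> (msize p <= k)%N.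
Proof.
move=> p0; rewrite msizeE; apply/bigmax_leqP_seq => m mp _.
rewrite ltnNge; apply/negP => /p0/eqP; apply/negP.
by rewrite -mcoeff_msupp.
Qed.

Lemma mcoeff_msize_le p k m : (msize p <= k)%N -> (k <= mdeg m)%N -> p@_m = 0.
Proof.
move=> pk km; apply: memN_msupp_eq0; apply: msize_mdeg_ge.
exact: leq_trans pk km.
Qed.

Lemma msize_mderiv p k j : (msize p <= k.+1)%N -> (msize p^`M(j) <= k)%N.
Proof.
move=> pk; apply: msize_leP => m km; rewrite mcoeff_deriv.
by rewrite (mcoeff_msize_le pk) ?mul0rn // mdegD mdeg1 addn1.
Qed.

Lemma msizeD_leq p q k :
  (msize p <= k -> msize q <= k -> msize (p + q) <= k)%N.
Proof. by move=> pk qk; rewrite (leq_trans (msizeD_le _ _)) // geq_max pk. Qed.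

Lemma msizeM_leq p q a b :
  (msize p <= a.+1 -> msize q <= b.+1 -> msize (p * q) <= (a + b).+1)%N.
Proof.
have [->|p0] := eqVneq p 0; first by rewrite mul0r msize0.
have [->|q0] := eqVneq q 0; first by rewrite mulr0 msize0.
have aux (x y : nat) : (x <= a.+1 -> y <= b.+1 -> (x + y).-1 <= (a + b).+1)%N by lia.
by move=> pa qb; rewrite msizeM //; apply: aux.
Qed.

Lemma msize_prod_leq I (s : seq I) (P : pred I) (G : I -> {mpoly F[n]}) (d : I -> nat) :
  (forall i, msize (G i) <= (d i).+1)%N ->
  (msize (\prod_(i <- s | P i) G i) <= (\sum_(i <- s | P i) d i).+1)%N.
Proof.
move=> Gd; elim/big_rec2: _ => [|i b q _ qb]; first by rewrite msize1.
exact: msizeM_leq.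
Qed.

Lemma msizeX_leq p d e : (msize p <= d.+1 -> msize (p ^+ e) <= (e * d).+1)%N.
Proof.
move=> pd; elim: e => [|e IHe]; first by rewrite expr0 msize1.
by rewrite exprS mulSn; apply: msizeM_leq.
Qed.

End MpolyEval.

(** * Jacobians and Newton lifting over an infinite field *)

Section InfiniteField.
Variables (r : nat) (F : numFieldType).
Implicit Types (h : 'I_r -> {mpoly F[r]}) (v : 'I_r -> F).

Lemma poly_nonroot (q : {poly F}) : q != 0 -> exists s, q.[s] != 0.
Proof.
move=> q0; pose s := [seq i%:R : F | i <- iota 0 (size q)].
have us : uniq s.
  by rewrite map_inj_uniq ?iota_uniq // => i j /eqP; rewrite eqr_nat => /eqP.
have [/(max_poly_roots q0)/(_ us)|/allPn[x _ qx]] := boolP (all (root q) s).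
  by rewrite size_map size_iota ltnn.
by exists x.
Qed.

Lemma mpoly_nonroot (p : {mpoly F[r]}) : p != 0 -> exists v, p.@[v] != 0.
Proof.
move=> p0; apply: contrapT => nv; move/eqP: p0; apply.
have {nv} pv v : p.@[v] = 0.
  by apply/eqP/negPn/negP => pv; apply: nv; exists v.
elim: {p}(msize p) {-2}p (leqnn (msize p)) pv => [|k IHk] p pk pv.
  by apply/eqP; rewrite -msize_poly_eq0 -leqn0.
have dp j : p^`M(j) = 0.
  apply: IHk => [|v]; first exact: msize_mderiv.
  pose w i : F := (i == j)%:R.
  have [e eP] := meval_poly_line v w p.
  have line0 : meval_poly (fun j => (v j)%:P + 'X * (w j)%:P) p = 0.
    apply/eqP/negPn/negP => /poly_nonroot[s].
    by rewrite horner_meval_poly pv eqxx.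
  have := congr1 (fun q : {poly F} => q`_1) eP.
  rewrite /grad_along line0 coef0 !coefD coefC coefXM coefC coefXnM /= add0r addr0.
  rewrite (bigD1 j) //= big1 => [|i ij]; last by rewrite /w (negbTE ij) mul0r.
  by rewrite /w eqxx mul1r addr0.
have pm m : m != 0%MM -> p@_m = 0.
  rewrite -mdeg_eq0 mdegE sum_nat_eq0 negb_forall => /existsP[j /= mj].
  have mE : m = (m - U_(j) + U_(j))%MM by rewrite submK // lep1mP.
  have := congr1 (mcoeff (m - U_(j))) (dp j); rewrite mcoeff_deriv mcoeff0 -mE.
  by move/eqP; rewrite mulrn_eq0 /= => /eqP.
have pC : p = (p@_0%MM)%:MP.
  apply/mpolyP => m; rewrite mcoeffC.
  by have [->|/pm ->] := eqVneq m 0%MM; rewrite ?mulr1 ?mulr0.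
by have := pv (fun=> 0); rewrite pC mevalC => ->; rewrite mpolyC0.
Qed.

Definition jacobian h v : 'M[F]_r := \matrix_(i, j) (h i)^`M(j).@[v].

Lemma factorX (q : {poly F}) : q.[0] = 0 -> exists g, q = 'X * g.
Proof.
by move=> /eqP/factor_theorem[g ->]; exists g; rewrite subr0 mulrC.
Qed.

(** Newton's iteration for [h(x) = t] starting at [v]. Solving modulo a power of ['X] keeps the arc
    polynomial, so no power series are needed. *)
Lemma newton_lift h v (t : 'I_r -> {poly F}) M :
  jacobian h v \in unitmx -> (forall i, (h i).@[v] = 0) ->
  (forall i, (t i).[0] = 0) ->
  exists2 x : 'I_r -> {poly F}, forall j, (x j).[0] = v j
    & forall i, exists g, meval_poly x (h i) - t i = 'X ^+ M.+1 * g.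
Proof.
move=> Ju hv t0; elim: M => [|M [x x0 /choice[g gE]]].
  exists (fun j => (v j)%:P) => [j|i]; first by rewrite hornerC.
  apply: factorX; rewrite hornerD hornerN t0 subr0 horner_meval_poly -[RHS](hv i).
  by apply: meval_eq => j; rewrite hornerC.
(* [y] is chosen to cancel the lowest term of the error. The Jacobian at [v] suffices, because its
   change along the arc only affects higher powers of ['X]. *)
pose y : 'cV[F]_r := invmx (jacobian h v) *m \col_i (g i).[0].
exists (fun j => x j + 'X ^+ M.+1 * - (y j 0)%:P) => [j|i].
  by rewrite hornerD hornerM hornerXn expr0n mul0r addr0.
have [e eP] := mmap_taylor (@polyC F) x (fun j => - (y j 0)%:P) ('X ^+ M.+1) (h i).
rewrite /meval_poly eP -/(meval_poly _ _).
have -> : meval_poly x (h i) = 'X ^+ M.+1 * g i + t i by rewrite -gE subrK.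
set s := \sum_j _.
have [g' g'E] : exists g', g i + s = 'X * g'.
  apply: factorX; rewrite hornerD /s horner_sum.
  have /matrixP/(_ i 0) : jacobian h v *m y = \col_i (g i).[0].
    by rewrite /y mulmxA mulmxV // mul1mx.
  rewrite !mxE => <-; rewrite -big_split big1 // => j _ /=.
  rewrite mxE hornerM hornerN hornerC -/(meval_poly _ _) horner_meval_poly.
  by rewrite (meval_eq _ x0) mulrN subrr.
exists (g' + 'X ^+ M * e).
have -> : 'X ^+ M.+1 * g i + t i + 'X ^+ M.+1 * s + 'X ^+ M.+1 ^+ 2 * e - t i =
  'X ^+ M.+1 * (g i + s) + 'X ^+ M.+1 ^+ 2 * e by ring.
by rewrite g'E !exprS; ring.
Qed.

Lemma dvdXn_eq0 (q g : {poly F}) M : (size q <= M)%N -> q = 'X ^+ M * g -> q = 0.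
Proof.
move=> sq eq; apply/polyP => i; rewrite coef0.
have [ltiM|leMi] := ltnP i M; first by rewrite eq coefXnM ltiM.
by rewrite nth_default // (leq_trans sq).
Qed.

(** If [Q] is nonzero at [w], the line ['X * w] lifts to an arc [x] on which [h] agrees with it to
    order beyond the degree of [Q] on the line. Then [Q(h) = 0] makes [Q] vanish on the line, in
    particular at [w]. *)
Lemma jacobian_independent h v (Q : {mpoly F[r]}) :
  jacobian h v \in unitmx -> (forall i, (h i).@[v] = 0) ->
  mmap (@mpolyC r F) h Q = 0 -> Q = 0.
Proof.
move=> Ju hv Qh; apply/eqP/negPn/negP => /mpoly_nonroot[w Qw].
pose t i := 'X * (w i)%:P; pose q := meval_poly t Q.
have q1 : q.[1] != 0.
  rewrite /q horner_meval_poly; move: Qw; congr (_ != 0).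
  by apply: meval_eq => j; rewrite hornerM hornerX hornerC mul1r.
have t0 i : (t i).[0] = 0 by rewrite hornerM hornerX mul0r.
have [x x0 /mmap_congr-/(_ F (@polyC F) Q)[g gE]] := newton_lift (size q) Ju hv t0.
have Qx : mmap (@polyC F) (fun i => meval_poly x (h i)) Q =
    meval_poly x (mmap (@mpolyC r F) h Q).
  elim/mpoly_rect_closed: Q {Qh Qw q q1 gE} => [a|i|q1 q2 e1 e2|q1 q2 e1 e2].
  - by rewrite /meval_poly !mmapC.
  - by rewrite !mmapX !mmap1U.
  - by rewrite /meval_poly !rmorphD /= e1 e2.
  - by rewrite /meval_poly !rmorphM /= e1 e2.
move: gE; rewrite Qx Qh /meval_poly rmorph0 sub0r => /eqP.
rewrite eqr_oppLR -mulrN => /eqP /dvdXn_eq0 q0.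
by move: q1; rewrite /q /meval_poly q0 ?horner0 ?eqxx.
Qed.

Lemma det_pencil_nonzero (A B : 'M[F]_r) :
  (A \in unitmx) || (B \in unitmx) -> exists2 q : {poly F}, q != 0 &
    forall s, q.[s] = \det (A + s *: (B - A)).
Proof.
pose q := \det (map_mx (@polyC F) A + 'X *: map_mx (@polyC F) (B - A)).
have qE s : q.[s] = \det (A + s *: (B - A)).
  rewrite -[LHS]/(horner_eval s q) -det_map_mx; congr (\det _).
  apply/matrixP => i j; rewrite !mxE /= /horner_eval hornerD hornerM hornerX.
  by rewrite !hornerC.
move=> AB; exists q => //; apply/eqP => q0; case/orP: AB; rewrite unitmxE unitfE.
  by move: (qE 0); rewrite scale0r addr0 q0 horner0 => <-; rewrite eqxx.
by move: (qE 1); rewrite scale1r addrC subrK q0 horner0 => <-; rewrite eqxx.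
Qed.

Section JacobianCombination.
Variables (I : eqType) (pt : I -> 'I_r -> F) (V : {mpoly F[r]} -> Prop).
Hypothesis V0 : V 0.
Hypothesis VD : forall p q, V p -> V q -> V (p + q).
Hypothesis VZ : forall c p, V p -> V (c *: p).
Hypothesis Vgrad : forall i (u : 'rV[F]_r), u != 0 ->
  exists2 p, V p & \sum_j u 0 j * p^`M(j).@[pt i] != 0.

(** Gradients are collected one at a time: as long as fewer than [r] are chosen, some [u] is
    orthogonal to all of them, and [Vgrad] supplies an element whose gradient is not. *)
Lemma jacobian_at_point i : exists2 h, forall l, V (h l)
  & jacobian h (pt i) \in unitmx.
Proof.
suff /(_ r (leqnn r)) [h Vh rk] : forall s, (s <= r)%N ->
    exists2 h : 'I_s -> {mpoly F[r]}, forall l, V (h l) &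
    \rank (\matrix_(l < s, j < r) (h l)^`M(j).@[pt i]) = s.
  by exists h => //; rewrite -row_free_unit /row_free rk.
elim=> [|s IHs] ltsr.
  by exists (fun=> 0) => //; apply/eqP; rewrite -leqn0 rank_leq_row.
have [h Vh rk] := IHs (ltnW ltsr); set G := (X in \rank X) in rk.
have [u u0 Gu] : exists2 u : 'rV[F]_r, u != 0 & u *m G^T = 0.
  have /rowV0Pn[u uker u0] : kermx G^T != 0.
    by rewrite -mxrank_eq0 mxrank_ker mxrank_tr rk subn_eq0 -ltnNge.
  by exists u => //; apply/sub_kermxP.
have [p Vp up] := Vgrad i u0.
pose w : 'rV[F]_r := \row_j p^`M(j).@[pt i].
have nwG : ~~ (w <= G)%MS.
  apply/negP => /submxP[c wE]; move/eqP: up; apply.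
  have := congr1 (fun A => u *m A^T) wE.
  rewrite trmx_mul mulmxA Gu mul0mx => /matrixP/(_ 0 0); rewrite !mxE => e; rewrite -[RHS]e.
  by apply: eq_bigr => j _; rewrite !mxE.
pose h' (l : 'I_s.+1) : {mpoly F[r]} := if unlift ord_max l is Some a then h a else p.
exists h'; first by move=> l; rewrite /h'; case: unliftP.
apply/eqP; rewrite eqn_leq rank_leq_row /=; set G' := (X in \rank X).
have GG' : (G <= G')%MS.
  apply/row_subP => a; have <- : row (lift ord_max a) G' = row a G.
    by apply/rowP => j; rewrite !mxE /h' liftK.
  exact: row_sub.
have wG' : (w <= G')%MS.
  have <- : row ord_max G' = w by apply/rowP => j; rewrite !mxE /h' unlift_none.
  exact: row_sub.
rewrite -[X in (X < _)%N]rk ltn_neqAle mxrankS // andbT; apply: contra nwG => /eqP rkGG'.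
by apply: submx_trans wG' _; rewrite -(geq_leqif (mxrank_leqif_sup GG')) rkGG'.
Qed.

(** A system good at the earlier points and one good at the new point are joined by a pencil. At
    each point the Jacobian determinant is a nonzero polynomial in the parameter, so some parameter
    serves all points. *)
Lemma jacobian_combination (s : seq I) : exists2 h, forall l, V (h l)
  & forall i, i \in s -> jacobian h (pt i) \in unitmx.
Proof.
elim: s => [|i s [h Vh Jh]]; first by exists (fun=> 0).
have [g Vg Jg] := jacobian_at_point i.
pose hs x l := h l + x *: (g l - h l).
have Jhs x j : jacobian (hs x) (pt j) =
    jacobian h (pt j) + x *: (jacobian g (pt j) - jacobian h (pt j)).
  apply/matrixP => a b; rewrite !mxE mderivD mevalD mderivZ mevalZ mderivB.
  by rewrite mevalB.
have det_q j : j \in i :: s -> exists2 q : {poly F}, q != 0 &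
    forall x, q.[x] = \det (jacobian (hs x) (pt j)).
  move=> js; have [|q q0 qE] := @det_pencil_nonzero (jacobian h (pt j)) (jacobian g (pt j)).
    by move: js; rewrite inE => /predU1P[->|/Jh ->//]; rewrite Jg orbT.
  by exists q => // x; rewrite qE Jhs.
have [Q Q0 QE] : exists2 Q : {poly F}, Q != 0 & forall x, Q.[x] != 0 ->
    forall j, j \in i :: s -> \det (jacobian (hs x) (pt j)) != 0.
  elim: (i :: s) det_q => [|j l IHl] det_q; first by exists 1; rewrite ?oner_eq0.
  have [|Q Q0 QE] := IHl; first by move=> j' j'l; apply: det_q; rewrite inE j'l orbT.
  have [q q0 qE] := det_q j (mem_head _ _).
  exists (q * Q) => [|x]; first by rewrite mulf_neq0.
  rewrite hornerM mulf_eq0 negb_or qE => /andP[qx Qx] j'.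
  by rewrite inE => /predU1P[->//|]; apply: QE.
have [x /QE Qx] := poly_nonroot Q0.
exists (hs x) => [l|j js]; last by rewrite unitmxE unitfE; apply: Qx.
apply: (VD) => //; apply: (VZ); apply: (VD) => //.
by rewrite -scaleN1r; apply: VZ.
Qed.

End JacobianCombination.

End InfiniteField.

Section Bezout.
Variables (r : nat) (F : numFieldType).

(** The coefficients lie on the moment curve [(1, s, s ^ 2, ...)]: each difference of two points
    excludes only the roots [s] of one nonzero polynomial. *)
Lemma separating_form (I : finType) (pt : I -> 'rV[F]_r) : injective pt ->
  exists2 l : {mpoly F[r]}, (msize l <= 2)%N & injective (fun i => l.@[pt i 0]).
Proof.
move=> inj; pose q (ij : I * I) := \poly_(a < r)
  (if insub a is Some b then (pt ij.1 - pt ij.2) 0 b else 0).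
have q0 ij : ij.1 != ij.2 -> q ij != 0.
  move=> ne; apply/eqP => qij; case/eqP: ne; apply: inj; apply/rowP => b.
  have := congr1 (fun p : {poly F} => p`_b) qij.
  rewrite coef_poly ltn_ord coef0 valK !mxE => /eqP.
  by rewrite subr_eq0 => /eqP.
have [|s] := @poly_nonroot F (\prod_(ij : I * I | ij.1 != ij.2) q ij).
  by apply/prodf_neq0 => ij; apply: q0.
rewrite horner_prod => /prodf_neq0 qs.
exists (\sum_(b < r) s ^+ b *: 'X_b).
  elim/big_ind: _ => [|p1 p2|b _]; first by rewrite msize0.
    exact: msizeD_leq.
  by apply: leq_trans (msizeZ_le _ _) _; rewrite msizeX mdeg1.
move=> i j eij; apply/eqP/negPn/negP => /(qs (i, j)); rewrite horner_poly => /eqP; apply.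
have ev k : (\sum_(b < r) s ^+ b *: 'X_b).@[pt k 0] = \sum_(b < r) pt k 0 b * s ^+ b.
  by rewrite raddf_sum; apply: eq_bigr => b _; rewrite /= mevalZ mevalXU mulrC.
move/eqP: eij; rewrite !ev -subr_eq0 -sumrB => /eqP e; rewrite -[RHS]e.
by apply: eq_bigr => b _; rewrite valK !mxE /= mulrBl.
Qed.

Lemma mmap_mpolyCE (h : 'I_r -> {mpoly F[r]}) (b : nat) (c : 'X_{1..r < b} -> F) :
  mmap (@mpolyC r F) h (\sum_m c m *: 'X_[m]) = \sum_m c m *: mmap1 h m.
Proof.
rewrite raddf_sum; apply: eq_bigr => m _.
by rewrite /= mmapZ mmapX mul_mpolyC.
Qed.

Lemma wide_dependence (T1 T2 : finType) (f : T1 -> T2 -> F) : (#|T2| < #|T1|)%N ->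
  exists2 c : T1 -> F, (exists a, c a != 0) & forall b, \sum_a c a * f a b = 0.
Proof.
move=> lt; pose A : 'M[F]_(#|T1|, #|T2|) := \matrix_(i, j) f (enum_val i) (enum_val j).
have /rowV0Pn[u /sub_kermxP uA /rV0Pn[i ui]] : kermx A != 0.
  by rewrite -mxrank_eq0 mxrank_ker subn_eq0 -ltnNge (leq_ltn_trans (rank_leq_col _)).
exists (fun a => u 0 (enum_rank a)).
  by exists (enum_val i); rewrite enum_valK.
move=> b; have /rowP/(_ (enum_rank b)) := uA; rewrite !mxE => e.
rewrite -[RHS]e (reindex _ (onW_bij _ (@enum_val_bij T1))); apply: eq_bigr => a _.
by rewrite mxE enum_valK enum_rankK.
Qed.

(** The products of [l ^ e], with [e <= N], and a monomial of degree at most [J] in [h] have degree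
    at most [d * J + N]. By [monomial_count] they outnumber the monomials of that degree, hence are
    dependent. So [l] satisfies an equation of degree at most [N] over [F[h]]. *)
Lemma polynomial_relation (d N : nat) (l : {mpoly F[r]}) (h : 'I_r -> {mpoly F[r]}) :
  (0 < d)%N -> (d ^ r <= N)%N -> (msize l <= 2)%N -> (forall i, msize (h i) <= d.+1)%N ->
  exists2 Q : 'I_N.+1 -> {mpoly F[r]}, exists e, Q e != 0
    & \sum_(e < N.+1) l ^+ e * mmap (@mpolyC r F) h (Q e) = 0.
Proof.
move=> d0 drN sl sh; have [J cJ] := monomial_count d0 drN.
pose E (a : 'I_N.+1 * 'X_{1..r < J.+1}) := l ^+ a.1 * mmap1 h a.2.
have sE a : (msize (E a) <= (d * J + N).+1)%N.
  case: a => e m; rewrite addnC; apply: leq_trans (_ : (e * 1 + mdeg m * d).+1 <= _)%N.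
    apply: msizeM_leq; first exact: msizeX_leq.
    rewrite /mmap1 mdegE big_distrl /=; apply: msize_prod_leq => i.
    exact: msizeX_leq.
  by have := ltn_ord e; have := bmdeg m => /=; nia.
have [|c [[e0 m0] c0] cE] := @wide_dependence _ 'X_{1..r < (d * J + N).+1}
    (fun a b => (E a)@_b).
  by rewrite card_prod card_ord.
exists (fun e => \sum_m c (e, m) *: 'X_[m]).
  exists e0; apply/eqP => /(congr1 (mcoeff m0)); rewrite mcoeff0 raddf_sum /=.
  rewrite (bigD1 m0) //= mcoeffZ mcoeffX eqxx mulr1 big1 => [|m mm0].
    by move/eqP; rewrite addr0 (negbTE c0).
  by rewrite mcoeffZ mcoeffX -bmeqP (negbTE mm0) mulr0.
under eq_bigr => e _ do rewrite mmap_mpolyCE mulr_sumr.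
rewrite pair_bigA /=; apply/mpolyP => m; rewrite mcoeff0.
rewrite raddf_sum /=.
have [lt|ge] := ltnP (mdeg m) (d * J + N).+1; last first.
  apply: big1 => -[e m'] _ /=; rewrite -scalerAr mcoeffZ.
  by rewrite (mcoeff_msize_le (sE (e, m')) ge) mulr0.
rewrite -[RHS](cE (BMultinom lt)); apply: eq_bigr => -[e m'] _ /=.
by rewrite -scalerAr mcoeffZ.
Qed.

(** Only the points other than [ord0] must be simple. If [d ^ r <= N], the values of [l] along arcs
    through the [N.+1] points, all with nearly the same image under [h], are approximate roots of
    one equation of degree at most [N]. They are distinct at ['X = 0], so all its coefficients are
    nearly zero, which fails for one of them. *)
Lemma bezout_points (d N : nat) (pt : 'I_N.+1 -> 'rV[F]_r) :
  (0 < d)%N -> injective pt ->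
  (forall i, i != ord0 -> forall u : 'rV[F]_r, u != 0 ->
    exists p, [/\ (msize p <= d.+1)%N, forall l, p.@[pt l 0] = 0
      & grad_along (u 0) (pt i 0) p != 0]) ->
  (N.+1 <= d ^ r)%N.
Proof.
move=> d0 inj grad; rewrite ltnNge; apply/negP => drN.
have [N0|N0] := posnP N; first by move: drN; rewrite N0 leqNgt expn_gt0 d0.
pose V (p : {mpoly F[r]}) := (msize p <= d.+1)%N /\ forall l, p.@[pt l 0] = 0.
pose I := {i : 'I_N.+1 | i != ord0}.
have [|||i u u0|h Vh Jh] := @jacobian_combination r F I (fun i => pt (val i) 0) V
    _ _ _ _ (enum {: I}).
- by split=> [|l]; rewrite ?msize0 ?meval0.
- move=> p q [sp vp] [sq vq]; split=> [|l]; first exact: msizeD_leq.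
  by rewrite mevalD vp vq addr0.
- move=> c p [sp vp]; split=> [|l]; first exact: leq_trans (msizeZ_le _ _) sp.
  by rewrite mevalZ vp mulr0.
- by have [p [sp vp up]] := grad _ (valP i) u u0; exists p.
have {}Jh i : i != ord0 -> jacobian h (pt i 0) \in unitmx.
  by move=> i0; have := Jh (Sub i i0); rewrite mem_enum => /(_ isT).
have [l sl l_inj] := separating_form inj.
have [|Q [e0 Qe0] rel] := polynomial_relation d0 drN sl (h := h).
  by move=> i; case: (Vh i).
have hpt i j : (h j).@[pt i 0] = 0 by case: (Vh j).
pose Qh e := mmap (@mpolyC r F) h (Q e).
have Qh0 : Qh e0 != 0.
  have i1 : (Ordinal (N0 : 1 < N.+1)%N) != ord0 by [].
  by apply: contraNneq Qe0 => /(jacobian_independent (Jh _ i1) (hpt _)) ->.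
have [v Qv] := mpoly_nonroot Qh0.
have subst (x : 'I_r -> {poly F}) p :
    meval_poly x (mmap (@mpolyC r F) h p) = meval_poly (fun j => meval_poly x (h j)) p.
  elim/mpoly_rect_closed: p => [a|i|q1 q2 e1 e2|q1 q2 e1 e2].
  - by rewrite /meval_poly !mmapC.
  - by rewrite /meval_poly !mmapX !mmap1U.
  - by rewrite rmorphD !meval_polyD e1 e2.
  - by rewrite rmorphM !meval_polyM e1 e2.
(* The arc [h x0] in the target is not contained in the zero set of [Q e0]; it
   starts at the common value 0 of [h], so it lifts to an arc through every
   point [pt i]. *)
pose x0 j := (pt ord0 0 j)%:P + 'X * (v j - pt ord0 0 j)%:P.
pose t j := meval_poly x0 (h j).
pose w e := meval_poly t (Q e).
have x00 j : (x0 j).[0] = pt ord0 0 j.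
  by rewrite hornerD hornerM hornerX mul0r addr0 hornerC.
have t0 j : (t j).[0] = 0.
  by rewrite /t horner_meval_poly (meval_eq _ x00) hpt.
have w0 : w e0 != 0.
  apply: contraNneq Qv => we0; have := congr1 (fun q : {poly F} => q.[1]) we0.
  rewrite /w -subst horner_meval_poly horner0 => <-; apply/eqP/meval_eq => j.
  by rewrite hornerD hornerM hornerX !hornerC mul1r addrC subrK.
(* The precision exceeds the degree of [w e0], so divisibility by ['X ^+ M.+1] is impossible for
   this nonzero polynomial. *)
pose M := size (w e0).
have lift i : exists x : 'I_r -> {poly F}, (forall j, (x j).[0] = pt i 0 j) /\
    forall j, exists g, meval_poly x (h j) - t j = 'X ^+ M.+1 * g.
  have [->|i0] := eqVneq i ord0.
    by exists x0; split=> // j; exists 0; rewrite mulr0 subrr.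
  by have [x] := newton_lift M (Jh _ i0) (hpt i) t0; exists x.
have {lift} [x xP] := choice lift.
have rel_i i : exists g, \sum_(e < N.+1) meval_poly (x i) l ^+ e * w e = 'X ^+ M.+1 * g.
  have [xi0 xih] := xP i.
  have /choice[g gE] : forall e, exists g,
      meval_poly (fun j => meval_poly (x i) (h j)) (Q e) - w e = 'X ^+ M.+1 * g.
    by move=> e; apply: mmap_congr.
  exists (- \sum_(e < N.+1) meval_poly (x i) l ^+ e * g e).
  have : meval_poly (x i) (\sum_(e < N.+1) l ^+ e * Qh e) = 0.
    by rewrite rel meval_poly0.
  rewrite meval_poly_sum => e; rewrite -[LHS]subr0 -[X in _ - X]e {e}.
  rewrite -sumrB mulrN mulr_sumr -sumrN; apply: eq_bigr => e _.
  rewrite meval_polyM meval_polyXn subst -mulrBr.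
  by rewrite -[w e - _]opprB gE mulrN mulrCA.
have /choice[g gE] := rel_i.
(* At ['X = 0] this is a Vandermonde matrix with distinct nodes, so its determinant is prime to
   ['X]. Multiplying by the adjugate transfers the divisibility from [A *m w] to each [w e]. *)
pose A : 'M[{poly F}]_N.+1 := \matrix_(i, e) meval_poly (x i) l ^+ e.
have Aw : A *m \col_e w e = 'X ^+ M.+1 *: \col_i g i.
  apply/colP => i; rewrite !mxE -gE; apply: eq_bigr => e _; by rewrite !mxE.
have detA : (\det A).[0] != 0.
  have -> : (\det A).[0] = \det (Vandermonde N.+1 (\row_i l.@[pt i 0])).
    rewrite -[LHS]/(horner_eval 0 (\det A)) -det_map_mx -det_tr; congr (\det _).
    apply/matrixP => e i; rewrite !mxE /= /horner_eval.
    by rewrite horner_exp horner_meval_poly; have [xi0 _] := xP i; rewrite (meval_eq _ xi0).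
  rewrite det_Vandermonde; apply/prodf_neq0 => i _; apply/prodf_neq0 => j ij.
  rewrite !mxE subr_eq0; apply/eqP => /l_inj ji; by rewrite ji ltnn in ij.
have := congr1 (mulmx (\adj A)) Aw.
rewrite mulmxA mul_adj_mx mul_scalar_mx -scalemxAr => /colP/(_ e0).
rewrite !mxE => dw.
have : 'X ^+ M.+1 %| w e0.
  have cop : coprimep ('X ^+ M.+1) (\det A).
    rewrite coprimep_expl // coprimep_sym.
    by rewrite -[X in coprimep _ X]subr0 coprimep_XsubC.
  by rewrite -(Gauss_dvdpr _ cop) dw dvdp_mulr.
by move/(dvdp_leq w0); rewrite size_polyXn /M ltnNge leqnSn.
Qed.

End Bezout.

(** * Generalized Wronskians *)

Lemma ratr_rmorphism (K : fieldType) : [pchar K] =i pred0 ->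
  exists rho : {rmorphism rat -> K}, forall q, rho q = ratr q.
Proof.
move=> charK; have int0 (z : int) : (z%:~R == 0 :> K) = (z == 0).
  case: z => n; first by rewrite -pmulrn (pcharf0P K).1.
  by rewrite NegzE mulrNz oppr_eq0 -pmulrn (pcharf0P K).1.
have ratrE (q : rat) (d z : int) : d != 0 -> q * d%:~R = z%:~R -> ratr q * d%:~R = z%:~R :> K.
  move=> d0 qd; have dq0 : ((denq q)%:~R : K) != 0 by rewrite int0 denq_eq0.
  apply: (mulIf dq0); rewrite /ratr mulrAC divfK // -!intrM; congr _%:~R.
  by apply: (@intr_inj rat); rewrite !intrM -qd numqE mulrAC.
have common (x y : rat) : exists d a b : int,
    [/\ d != 0, x * d%:~R = a%:~R & y * d%:~R = b%:~R].
  exists (denq x * denq y), (numq x * denq y), (numq y * denq x).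
  by rewrite mulf_neq0 ?denq_eq0 // !intrM !numqE; split=> //; ring.
have ratrB : zmod_morphism (@ratr K).
  move=> x y; have [d [a [b [d0 xd yd]]]] := common x y.
  have d0K : (d%:~R : K) != 0 by rewrite int0.
  apply: (mulIf d0K); rewrite mulrBl (ratrE _ _ _ d0 xd) (ratrE _ _ _ d0 yd).
  by rewrite (ratrE _ _ (a - b) d0) ?rmorphB //= mulrBl xd yd.
have ratrM : monoid_morphism (@ratr K).
  split=> [|x y]; first by rewrite /ratr divr1.
  have [d [a [b [d0 xd yd]]]] := common x y.
  have d0K : (d%:~R : K) != 0 by rewrite int0.
  apply: (mulIf d0K); apply: (mulIf d0K).
  have -> : ratr x * ratr y * d%:~R * d%:~R = a%:~R * b%:~R :> K.
    by rewrite -(ratrE _ _ _ d0 xd) -(ratrE _ _ _ d0 yd); ring.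
  rewrite -mulrA -!intrM; apply: ratrE; first by rewrite mulf_neq0.
  by rewrite !intrM -xd -yd; ring.
pose rB := GRing.isZmodMorphism.Build rat K (@ratr K) ratrB.
pose rM := GRing.isMonoidMorphism.Build rat K (@ratr K) ratrM.
pose rho : {rmorphism rat -> K} := HB.pack (@ratr K) rB rM.
by exists rho.
Qed.

Section BorderedDeterminant.
Variable R : fieldType.

Definition fcons m (X : Type) (x : X) (f : 'I_m -> X) (i : 'I_m.+1) : X :=
  oapp f x (unlift ord0 i).

Lemma fcons0 m X (x : X) (f : 'I_m -> X) : fcons x f ord0 = x.
Proof. by rewrite /fcons unlift_none. Qed.

Lemma fconsS m X (x : X) (f : 'I_m -> X) i : fcons x f (lift ord0 i) = f i.
Proof. by rewrite /fcons liftK. Qed.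

Lemma det_block m (T : 'M[R]_m) (e : 'M_1) (b : 'rV_m) (v : 'cV_m) : T \in unitmx ->
  \det (block_mx e b v T) = \det T * (e - b *m invmx T *m v) 0 0.
Proof.
move=> Tu; have -> : block_mx e b v T =
    block_mx 1%:M (b *m invmx T) 0 1%:M *m block_mx (e - b *m invmx T *m v) 0 v T.
  by rewrite mulmx_block !mul1mx !mul0mx !add0r subrK mulmxKV.
by rewrite det_mulmx det_ublock det_lblock !det1 !mul1r mulrC det_mx11.
Qed.

(** Schur complement: [mu] solves the system given by the rows [W] alone, so one [mu] serves all
    [w]. The index types are arbitrary because columns may be functions or formal variations. *)
Lemma det_border (X Y : Type) (A : X -> Y -> R) m (W : 'I_m -> X) (f : 'I_m -> Y) g :
  \det (\matrix_(p, q) A (W p) (f q)) != 0 ->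
  exists mu : 'I_m -> R, forall w,
    \det (\matrix_(p < m.+1, q < m.+1) A (fcons w W p) (fcons g f q)) = 0 ->
    A w g = \sum_q A w (f q) * mu q.
Proof.
set T := \matrix_(p, q) _ => dT; have Tu : T \in unitmx by rewrite unitmxE unitfE.
pose v : 'cV_m := \col_p A (W p) g.
exists (fun q => (invmx T *m v) q 0) => w.
set N := \matrix_(p, q) _.
have -> : N = block_mx (A w g)%:M (\row_q A w (f q)) v T :> 'M_(1 + m).
  have l0 : ord0 = lshift m (ord0 : 'I_1) :> 'I_(1 + m) by apply: val_inj.
  apply/matrixP => p q; rewrite mxE; case: (unliftP ord0 p) => [p'|] ->;
    case: (unliftP ord0 q) => [q'|] ->; rewrite ?fcons0 ?fconsS -?rshift1.
  - by rewrite (block_mxEdr (m1 := 1) (n1 := 1)) mxE.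
  - by rewrite l0 (block_mxEdl (m1 := 1) (n1 := 1)) mxE.
  - by rewrite l0 (block_mxEur (m1 := 1) (n1 := 1)) mxE.
  - by rewrite l0 (block_mxEul (m1 := 1) (n1 := 1)) !mxE.
move/eqP; rewrite det_block // mulf_eq0 (negbTE dT) /= -mulmxA !mxE subr_eq0 => /eqP.
rewrite mulr1n => ->.
by apply: eq_bigr => q _; rewrite !mxE.
Qed.

Lemma det_ker0 m (A : 'M[R]_m) (c : 'I_m -> R) : \det A != 0 ->
  (forall p, \sum_q A p q * c q = 0) -> forall q, c q = 0.
Proof.
move=> dA Ac q; have Au : A \in unitmx by rewrite unitmxE unitfE.
have : A *m \col_q c q = 0.
  by apply/colP => p; rewrite !mxE -[RHS](Ac p); apply: eq_bigr => s _; rewrite mxE.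
move/(congr1 (mulmx (invmx A))); rewrite mulKmx // mulmx0 => /colP/(_ q).
by rewrite !mxE.
Qed.

End BorderedDeterminant.

Section Wronskian.
Variables (k : closedFieldType) (K : fieldType) (iota : {rmorphism k -> K}).
Hypothesis charK : [pchar K] =i pred0.

Definition apply_word (w : seq (derivation iota)) (x : K) : K :=
  foldr (fun (D : derivation iota) y => D y) x w.

Lemma apply_wordB w : {morph apply_word w : x y / x - y}.
Proof. by move=> x y; elim: w => //= D w ->; rewrite raddfB. Qed.

Fact apply_word_zmod w : zmod_morphism (apply_word w). Proof. exact: apply_wordB. Qed.
HB.instance Definition _ w :=
  GRing.isZmodMorphism.Build K K (apply_word w) (apply_word_zmod w).

Lemma apply_wordZ w c x : apply_word w (iota c * x) = iota c * apply_word w x.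
Proof. by elim: w => //= D w ->; rewrite derZ. Qed.

Lemma apply_word_lin w m (c : 'I_m -> k) (f : 'I_m -> K) :
  apply_word w (\sum_q iota (c q) * f q) = \sum_q iota (c q) * apply_word w (f q).
Proof. by rewrite raddf_sum; apply: eq_bigr => q _; rewrite /= apply_wordZ. Qed.

Definition kfree m (f : 'I_m -> K) : Prop :=
  forall c : 'I_m -> k, \sum_q iota (c q) * f q = 0 -> forall q, c q = 0.

(* Wronskians grow by a border at index 0, so the longest word comes first. *)
Definition short_words m (W : 'I_m -> seq (derivation iota)) : Prop :=
  forall p : 'I_m, (size (W p) + p < m)%N.

Lemma short_fcons m w (W : 'I_m -> seq (derivation iota)) :
  (size w <= m)%N -> short_words W -> short_words (fcons w W).
Proof.
move=> sw sW p; case: (unliftP ord0 p) => [p'|] ->; last by rewrite fcons0 addn0 ltnS.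
by rewrite fconsS lift0 addnS ltnS; apply: sW.
Qed.

(** If every border of a nonzero smaller Wronskian vanishes, [g] and its derivatives are
    combinations of those of [f'] with common coefficients [mu]. Differentiating shows that the [mu]
    are killed by all derivations, hence lie in [k], against freeness. *)
Lemma wronskian_neq0 m (f : 'I_m -> K) : kfree f ->
  exists2 W : 'I_m -> seq (derivation iota), short_words W
    & \det (\matrix_(p, q) apply_word (W p) (f q)) != 0.
Proof.
elim: m f => [|m IHm] f free_f.
  by exists (fun=> [::]) => [[]//|]; rewrite det_mx00 oner_eq0.
pose f' q := f (lift ord0 q); pose g := f ord0.
have fE : f =1 fcons g f'.
  by move=> q; case: (unliftP ord0 q) => [q'|] ->; rewrite ?fcons0 ?fconsS.
have free_f' : kfree f'.
  move=> c cf q; have := free_f (fcons 0 c) _ (lift ord0 q); rewrite fconsS; apply.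
  rewrite big_ord_recl fcons0 rmorph0 mul0r add0r -[RHS]cf.
  by apply: eq_bigr => s _; rewrite fconsS.
have [W sW dW] := IHm _ free_f'.
have [mu muE] := det_border g dW.
apply: contrapT => nW.
have {}muE w : (size w <= m)%N ->
    apply_word w g = \sum_q apply_word w (f' q) * mu q.
  move=> sw; apply: muE; apply/eqP/negPn/negP => dN; apply: nW.
  exists (fcons w W); first exact: short_fcons.
  move: dN; congr (\det _ != 0); apply/matrixP => p q.
  by rewrite !mxE fE.
have mu_const q : constant iota (mu q).
  apply: der0_constant => // D; move: q; apply: (det_ker0 dW) => p.
  under eq_bigr => q _ do rewrite mxE.
  have sp : (size (W p) < m)%N by apply: leq_ltn_trans (sW p); rewrite leq_addr.
  (* The words in [W] have size below [m], so one more derivation is still allowed; the relation for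
     [D :: W p] is compared with [D] applied to the relation for [W p]. *)
  have /= := muE (D :: W p) sp; rewrite muE 1?ltnW // raddf_sum => e.
  apply/eqP; rewrite -(inj_eq (addrI (\sum_q apply_word (D :: W p) (f' q) * mu q))).
  by rewrite addr0 -{2}e -big_split; apply/eqP; apply: eq_bigr => q _; rewrite /= derM.
have /choice[c cE] : forall q, exists c, iota c = mu q.
  by move=> q; have [c _ <-] := mu_const q; exists c.
have c0 : \sum_q iota (fcons 1 (fun q => - c q) q) * f q = 0.
  rewrite big_ord_recl fcons0 rmorph1 mul1r -/g [g](muE [::] (leq0n m)).
  rewrite -big_split big1 //= => q _.
  by rewrite fconsS rmorphN /= cE -/(f' q); ring.
by have := free_f _ c0 ord0; rewrite fcons0 => /eqP; rewrite oner_eq0.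
Qed.

End Wronskian.

(** * Words of derivations as polynomials in the exponents *)

Section LogarithmicPoints.
Variables (k : closedFieldType) (K : fieldType) (iota : {rmorphism k -> K}).
Variables (rho : {rmorphism rat -> K}) (r : nat) (I : finType).
Variables (a : I -> K) (g : 'I_r -> I -> K).
Implicit Types (D : derivation iota) (q u : 'I_r -> rat) (i : I).

Lemma der_rat D c : D (rho c) = 0.
Proof.
have der_int (z : int) : D z%:~R = 0 by rewrite raddfMz /= der1 mul0rz.
have den0 : rho (denq c)%:~R != 0 by rewrite fmorph_eq0 intr_eq0 denq_eq0.
apply: (mulIf den0); rewrite mul0r -[LHS]addr0.
have : D (rho c * rho (denq c)%:~R) = 0 by rewrite -rmorphM -numqE rmorph_int.
by rewrite derM rmorph_int der_int mulr0.
Qed.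

(* f has the logarithmic derivatives of the family a_i prod_j g_ji ^ q_j. *)
Definition log_point (q : 'I_r -> rat) (f : I -> K) : Prop :=
  (forall i, f i != 0) /\ forall D i,
    logder D (f i) = logder D (a i) + \sum_j rho (q j) * logder D (g j i).

Definition log_form D i : {mpoly K[r]} :=
  (logder D (a i))%:MP + \sum_j logder D (g j i) *: 'X_j.

(** The quotient of [apply_word w (f i)] by [f i], as a polynomial in the exponents. [map_mpoly D]
    differentiates coefficients only, which is correct at rational points because [D] kills their
    coordinates. *)
Fixpoint word_poly (w : seq (derivation iota)) i : {mpoly K[r]} :=
  if w is D :: w' then
    map_mpoly D (word_poly w' i) + word_poly w' i * log_form D i
  else 1.

Lemma msize_map_mpoly D (p : {mpoly K[r]}) : (msize (map_mpoly D p) <= msize p)%N.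
Proof.
apply: msize_leP => m pm; rewrite mcoeff_map_mpoly (mcoeff_msize_le (leqnn _)) //.
exact: raddf0.
Qed.

Lemma msize_log_form D i : (msize (log_form D i) <= 2)%N.
Proof.
apply: msizeD_leq; first by rewrite msizeC; case: eqP.
elim/big_ind: _ => [|p1 p2|j _]; first by rewrite msize0.
  exact: msizeD_leq.
by apply: leq_trans (msizeZ_le _ _) _; rewrite msizeX mdeg1.
Qed.

Lemma msize_word_poly w i : (msize (word_poly w i) <= (size w).+1)%N.
Proof.
elim: w => [|D w IHw] /=; first by rewrite msize1.
apply: msizeD_leq; first by rewrite (leq_trans (msize_map_mpoly _ _)) // ltnW.
by rewrite -addn1; apply: msizeM_leq => //; apply: msize_log_form.
Qed.

Lemma meval_map_mpoly D (p : {mpoly K[r]}) q :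
  (map_mpoly D p).@[fun j => rho (q j)] = D p.@[fun j => rho (q j)].
Proof.
pose v j := rho (q j); rewrite -/v.
have Dv m : D (\prod_i v i ^+ m i) = 0.
  by rewrite -[RHS](der_rat D (\prod_i q i ^+ m i)) rmorph_prod; congr (D _);
    apply: eq_bigr => i _; rewrite rmorphXn.
elim/mpolyind: p => [|c m p _ _ IHp]; first by rewrite !raddf0.
rewrite !raddfD /= IHp; congr (_ + _).
have -> : map_mpoly D (c *: 'X_[m]) = D c *: 'X_[m].
  apply/mpolyP => m'; rewrite mcoeff_map_mpoly !mcoeffZ mcoeffX.
  by case: eqP => _; rewrite ?mulr1 // !mulr0 raddf0.
by rewrite !mevalZ mevalX derM Dv mulr0 addr0.
Qed.

Lemma mderiv_map_mpoly D (p : {mpoly K[r]}) j :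
  (map_mpoly D p)^`M(j) = map_mpoly D p^`M(j).
Proof.
apply/mpolyP => m; rewrite mcoeff_deriv !mcoeff_map_mpoly mcoeff_deriv.
by rewrite raddfMn.
Qed.

Lemma word_polyP q f w i : log_point q f ->
  apply_word w (f i) = f i * (word_poly w i).@[fun j => rho (q j)].
Proof.
case=> f0 fL; elim: w => [|D w IHw] /=; first by rewrite meval1 mulr1.
rewrite IHw derM mevalD meval_map_mpoly mevalM mulrDr addrC; congr (_ + _).
rewrite mulrCA mulrC; congr (_ * _).
have -> : (log_form D i).@[fun j => rho (q j)] = logder D (f i).
  rewrite fL /log_form mevalD mevalC; congr (_ + _); rewrite raddf_sum.
  by apply: eq_bigr => j _; rewrite /= mevalZ mevalXU mulrC.
by rewrite /logder mulrC divfK.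
Qed.

(** The logarithmic derivative of the formal power [prod_j g_ji ^ u_j], that is, the rate at which
    the logarithmic derivative of [f i] changes when [q] moves along [u]. *)
Definition theta u D i : K := \sum_j rho (u j) * logder D (g j i).

Definition word_variation q u f w i : K :=
  f i * grad_along (fun j => rho (u j)) (fun j => rho (q j)) (word_poly w i).

(** To first order in [e], the variation describes words in the operators [D + e * theta] applied to
    the fixed [f i]. *)
Lemma word_variation_cons q u f D w i : log_point q f ->
  word_variation q u f (D :: w) i =
  D (word_variation q u f w i) + apply_word w (f i) * theta u D i.
Proof.
move=> lpf; have [f0 fL] := lpf; rewrite (word_polyP _ _ lpf) /word_variation.
set P := word_poly w i; set v := fun j => rho (q j); set uu := fun j => rho (u j).
have dD : grad_along uu v (map_mpoly D P) = D (grad_along uu v P).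
  rewrite /grad_along raddf_sum; apply: eq_bigr => j _ /=.
  by rewrite derM der_rat mul0r add0r mderiv_map_mpoly meval_map_mpoly.
have lf : (log_form D i).@[v] = logder D (f i).
  rewrite fL /log_form mevalD mevalC; congr (_ + _); rewrite raddf_sum.
  by apply: eq_bigr => j _; rewrite /= mevalZ mevalXU mulrC.
have dl j : ((log_form D i)^`M(j)).@[v] = logder D (g j i).
  rewrite /log_form mderivD mderivC add0r.
  rewrite (_ : _^`M(j) = \sum_j' (logder D (g j' i) *: 'X_j')^`M(j)); last first.
    exact: (raddf_sum (@mderiv _ _ j)).
  rewrite raddf_sum /=.
  rewrite (bigD1 j) //= big1 ?addr0 => [|j' j'j].
    rewrite mderivZ mevalZ mderivX mnm1E eqxx scale1r.
    have -> : (U_(j) - U_(j) = 0 :> 'X_{1..r})%MM.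
      by apply/mnmP => s; rewrite mnmBE subnn mnm0E.
    by rewrite mpolyX0 meval1 mulr1.
  by rewrite mderivZ mderivX mnm1E (negbTE j'j) scale0r scaler0 meval0.
have -> : grad_along uu v (word_poly (D :: w) i) = D (grad_along uu v P)
    + grad_along uu v P * logder D (f i) + P.@[v] * theta u D i.
  rewrite [word_poly _ _]/= -/P; move: (log_form D i) lf dl => L <- dl.
  rewrite -dD /grad_along /theta mulr_suml mulr_sumr -!big_split.
  apply: eq_bigr => j _ /=.
  by rewrite mderivD mderivM !mevalD !mevalM dl -[rho (u j)]/(uu j); ring.
rewrite derM /logder !mulrDr; congr (_ + _); last by rewrite mulrA.
by rewrite addrC; congr (_ + _); field.
Qed.

End LogarithmicPoints.

Lemma det_scale_col (R : comNzRingType) m (A : 'M[R]_m) (c : 'I_m -> R) :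
  \det (\matrix_(i, j) (A i j * c j)) = (\prod_j c j) * \det A.
Proof.
have -> : \matrix_(i, j) (A i j * c j) = A *m diag_mx (\row_j c j).
  by rewrite mul_mx_diag; apply/matrixP => i j; rewrite !mxE.
rewrite det_mulmx det_diag mulrC; congr (_ * _).
by apply: eq_bigr => j _; rewrite mxE.
Qed.

Section Minors.
Variables (k : closedFieldType) (K : fieldType) (iota : {rmorphism k -> K}).
Variables (rho : {rmorphism rat -> K}) (r : nat) (I : finType).
Variables (a : I -> K) (g : 'I_r -> I -> K).
Implicit Types (D : derivation iota) (q u : 'I_r -> rat) (i : I) (f : I -> K).

Local Notation word := (seq (derivation iota)).
Local Notation word_poly := (@word_poly k K iota r I a g).
Local Notation log_point := (@log_point k K iota rho r I a g).
Local Notation pt q := (fun j => rho (q j)).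

Definition minor m (W : 'I_m -> word) (s : 'I_m -> I) : {mpoly K[r]} :=
  \det (\matrix_(p, t) word_poly (W p) (s t)).

(** Row [p] has degree at most [m - 1 - p]; these numbers sum to ['C(m, 2)]. *)
Lemma msize_minor m (W : 'I_m -> word) (s : 'I_m -> I) : short_words W ->
  (msize (minor W s) <= 'C(m, 2).+1)%N.
Proof.
move=> sW; rewrite /minor /determinant.
elim/big_ind: _ => [|p1 p2|sg _]; first by rewrite msize0.
  exact: msizeD_leq.
rewrite -[X in X.+1]add0n; apply: msizeM_leq.
  rewrite -signr_odd; case: odd; last by rewrite expr0 msize1.
  by rewrite expr1 msizeN msize1.
apply: leq_trans (_ : (\sum_(p < m) size (W p)).+1 <= _)%N.
  by apply: msize_prod_leq => p; rewrite mxE; apply: msize_word_poly.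
rewrite ltnS -bin2_sum big_mkord (reindex_inj rev_ord_inj); apply: leq_sum => p _.
by rewrite /=; have := sW (rev_ord p); rewrite /=; have := ltn_ord p; lia.
Qed.

Lemma minorP m (W : 'I_m -> word) (s : 'I_m -> I) q f : log_point q f ->
  (\prod_t f (s t)) * (minor W s).@[pt q] =
  \det (\matrix_(p, t) apply_word (W p) (f (s t))).
Proof.
move=> lpf; rewrite /minor -det_map_mx -det_scale_col; congr (\det _).
by apply/matrixP => p t; rewrite !mxE (word_polyP _ _ lpf) mulrC.
Qed.

Lemma minor_eq0 m (W : 'I_m -> word) (s : 'I_m -> I) q f : log_point q f ->
  ~ kfree iota (f \o s) -> (minor W s).@[pt q] = 0.
Proof.
move=> lpf nfree; have [f0 _] := lpf.
have pf0 : \prod_t f (s t) != 0 by apply/prodf_neq0 => t _.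
apply: (mulfI pf0); rewrite mulr0 (minorP _ _ lpf).
apply/eqP/negPn/negP => dA; apply: nfree => c cf t.
apply: (fmorph_inj iota); rewrite rmorph0; move: t.
apply: (det_ker0 dA) => p; under eq_bigr => t _ do rewrite mxE mulrC.
by rewrite -apply_word_lin cf raddf0.
Qed.

Definition relation_variation q u f m (s : 'I_m -> I) i (E : 'I_m -> k) (w : word) : K :=
  word_variation rho a g q u f w i
  - \sum_t iota (E t) * word_variation rho a g q u f w (s t).

(** At the point itself column 0 is a [k]-combination of the others, and the same combination holds
    for every word. After subtracting it, only the variation of column 0 contributes to the
    first-order term. That column is labelled [None], so that [det_border] can treat it as one more
    column. *)
Lemma grad_minor m (W : 'I_m -> word) (s : 'I_m -> I) w i q u f (E : 'I_m -> k) :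
  log_point q f -> f i = \sum_t iota (E t) * f (s t) ->
  (\prod_t f (fcons i s t)) * grad_along (pt u) (pt q) (minor (fcons w W) (fcons i s)) =
  \det (\matrix_(p < m.+1, t < m.+1)
     oapp (fun i' => apply_word (fcons w W p) (f i'))
       (relation_variation q u f s i E (fcons w W p)) (fcons None (Some \o s) t)).
Proof.
move=> lpf fE; have [f0 _] := lpf.
pose x j := (rho (q j))%:P + 'X * (rho (u j))%:P.
pose N : 'M[{poly K}]_m.+1 := \matrix_(p, t)
  (meval_poly x (word_poly (fcons w W p) (fcons i s t)) * (f (fcons i s t))%:P).
have lineE p i' : exists e, meval_poly x (word_poly p i') * (f i')%:P =
    (apply_word p (f i'))%:P + 'X * (word_variation rho a g q u f p i')%:P + 'X ^+ 2 * e.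
  have [e eP] := meval_poly_line (pt q) (pt u) (word_poly p i').
  exists (e * (f i')%:P); rewrite /x eP (word_polyP _ _ lpf) /word_variation !polyCM.
  by ring.
have {lineE} /choice[e eP] : forall z : word * I, exists e,
    meval_poly x (word_poly z.1 z.2) * (f z.2)%:P = (apply_word z.1 (f z.2))%:P
    + 'X * (word_variation rho a g q u f z.1 z.2)%:P + 'X ^+ 2 * e.
  by case=> p i'; apply: lineE.
have detN : (\det N)`_1 =
    (\prod_t f (fcons i s t)) * grad_along (pt u) (pt q) (minor (fcons w W) (fcons i s)).
  pose c t : {poly K} := (f (fcons i s t))%:P.
  pose WP := \matrix_(p < m.+1, t < m.+1) word_poly (fcons w W p) (fcons i s t).
  have -> : N = \matrix_(p, t) (map_mx (mmap (@polyC K) x) WP p t * c t).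
    by apply/matrixP => p t; rewrite !mxE.
  rewrite det_scale_col det_map_mx -/(minor _ _) -rmorph_prod coefCM; congr (_ * _).
  have [e' e'P] := meval_poly_line (pt q) (pt u) (minor (fcons w W) (fcons i s)).
  have := congr1 (fun z : {poly K} => z`_1) e'P.
  by rewrite !coefD coefC coefXM coefC coefXnM /= add0r addr0.
rewrite -detN.
(* The column operation, of determinant 1, that makes column 0 of [N] divisible by ['X]; [N'] is the
   result after division by ['X]. *)
pose U : 'M[{poly K}]_m.+1 := \matrix_(p, t)
  if t == ord0 then fcons 1 (fun b => - (iota (E b))%:P) p else (p == t)%:R.
have detU : \det U = 1.
  rewrite det_trig => [|]; last first.
    apply/is_trig_mxP => p t lt; rewrite mxE.
    have -> : (t == ord0) = false by apply/negbTE; rewrite -lt0n (leq_ltn_trans _ lt).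
    by rewrite -val_eqE (ltn_eqF lt).
  rewrite big1 // => p _; rewrite mxE eqxx.
  by case: eqP => // ->; rewrite fcons0.
pose N' : 'M[{poly K}]_m.+1 := \matrix_(p, t)
  if t == ord0 then (relation_variation q u f s i E (fcons w W p))%:P
    + 'X * (e (fcons w W p, i) - \sum_b (iota (E b))%:P * e (fcons w W p, s b))
  else N p t.
have NU : N *m U = \matrix_(p, t) (N' p t * (if t == ord0 then 'X else 1)).
  apply/matrixP => p t; rewrite !mxE.
  have [->|t0] := eqVneq t ord0; last first.
    rewrite mulr1 (bigD1 t) //= !mxE (negbTE t0) eqxx mulr1 big1 ?addr0 //.
    by move=> b bt; rewrite !mxE (negbTE t0) (negbTE bt) mulr0.
  rewrite big_ord_recl !mxE eqxx !fcons0 mulr1 (eP (fcons w W p, i)) /=.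
  under eq_bigr => b _.
    rewrite !mxE eqxx !fconsS (eP (fcons w W p, s b)) /=.
    over.
  set w' := fcons w W p.
  have rel0 : apply_word w' (f i) = \sum_b iota (E b) * apply_word w' (f (s b)).
    by rewrite fE apply_word_lin.
  rewrite rel0 /relation_variation -/w' rmorphB !rmorph_sum /=.
  have -> : \sum_(b < m) ((apply_word w' (f (s b)))%:P
      + 'X * (word_variation rho a g q u f w' (s b))%:P + 'X^2 * e (w', s b))
      * - (iota (E b))%:P =
    - (\sum_(b < m) (iota (E b) * apply_word w' (f (s b)))%:P)
    - 'X * (\sum_(b < m) (iota (E b) * word_variation rho a g q u f w' (s b))%:P)
    - 'X^2 * \sum_(b < m) (iota (E b))%:P * e (w', s b).
    rewrite !mulr_sumr -!sumrN -!big_split; apply: eq_bigr => b _ /=.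
    by rewrite !polyCM; ring.
  by ring.
have -> : \det N = 'X * \det N'.
  rewrite -[LHS]mulr1 -detU -det_mulmx NU det_scale_col big_ord_recl eqxx.
  by rewrite big1 ?mulr1.
rewrite coefXM /= -horner_coef0 -[LHS]/(horner_eval 0 (\det N')) -det_map_mx.
congr (\det _); apply/matrixP => p t; rewrite !mxE /= /horner_eval.
case: (unliftP ord0 t) => [b|] ->.
  rewrite eq_sym (negbTE (neq_lift _ _)) !fconsS /=.
  rewrite (eP (fcons w W p, s b)) /=.
  by rewrite !hornerD !hornerM !hornerX !hornerC !mul0r !addr0.
by rewrite eqxx !fcons0 /= hornerD hornerM hornerX hornerC mul0r addr0.
Qed.

End Minors.

(** * Simplicity of the zeros *)

Lemma common_denominator r (u : 'I_r -> rat) :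
  exists2 d : int, d != 0 & exists U : 'I_r -> int, forall j, u j * d%:~R = (U j)%:~R.
Proof.
exists (\prod_j denq (u j)); first by apply/prodf_neq0 => j _; apply: denq_neq0.
exists (fun j => numq (u j) * \prod_(j' | j' != j) denq (u j')) => j.
by rewrite (bigD1 j) //= !intrM numqE mulrA.
Qed.

Section Tangent.
Variables (k : closedFieldType) (K : fieldType) (iota : {rmorphism k -> K}).
Hypothesis charK : [pchar K] =i pred0.
Variables (rho : {rmorphism rat -> K}) (r : nat) (I : finType).
Variables (a : I -> K) (g : 'I_r -> I -> K) (i0 : I).
Hypothesis g_neq0 : forall j i, g j i != 0.
Hypothesis g_i0 : forall j, g j i0 = 1.
Hypothesis g_indep : forall U : 'I_r -> int,
  (forall i, constant iota (\prod_j g j i ^ U j)) -> forall j, U j = 0.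
Implicit Types (D : derivation iota) (q u : 'I_r -> rat) (i : I) (f : I -> K).

Local Notation word := (seq (derivation iota)).
Local Notation log_point := (@log_point k K iota rho r I a g).
Local Notation theta := (@theta k K iota rho r I g).
Local Notation minor := (@minor k K iota r I a g).
Local Notation pt q := (fun j => rho (q j)).

Definition vanishing_sum f : Prop :=
  \sum_i f i = 0 /\
  forall S : {set I}, S != finset.set0 -> S != finset.setT -> \sum_(i in S) f i != 0.

Definition rank_lt f m : Prop := forall s : 'I_m -> I, ~ kfree iota (f \o s).

Lemma kfree_span f m (s : 'I_m -> I) : kfree iota (f \o s) -> rank_lt f m.+1 ->
  forall i, exists E : 'I_m -> k, f i = \sum_t iota (E t) * f (s t).
Proof.
move=> free_s rk i; have /existsNP[c] := rk (fcons i s).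
rewrite not_implyE => -[cf nc].
move: cf; rewrite big_ord_recl /= fcons0.
under eq_bigr => t _ do rewrite /= fconsS.
move=> cf; have c0 : c ord0 != 0.
  apply/eqP => c0; apply: nc => t; move: cf; rewrite c0 rmorph0 mul0r add0r.
  move=> /(free_s (fun t => c (lift ord0 t))) cl.
  by case: (unliftP ord0 t) => [t'|] ->.
exists (fun t => - c (lift ord0 t) / c ord0).
have ic0 : iota (c ord0) != 0 by rewrite fmorph_eq0.
apply: (mulfI ic0); move/eqP: cf; rewrite addr_eq0 => /eqP ->.
rewrite mulr_sumr -sumrN; apply: eq_bigr => t _.
by rewrite fmorph_div rmorphN; field.
Qed.

(** Vanishing gradients let [det_border] write the variation of the relation for [f i] as
    [sum_t w(f (s t)) * mu t] for all short [w]. Comparing [D :: W p] with [D] applied to this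
    identity leaves a homogeneous system with the nonzero Wronskian as determinant. *)
Lemma exact_difference q f m (s : 'I_m -> I) u :
  log_point q f -> kfree iota (f \o s) -> rank_lt f m.+1 ->
  (forall W s', short_words W -> grad_along (pt u) (pt q) (@minor m.+1 W s') = 0) ->
  forall i (E : 'I_m -> k), f i = \sum_t iota (E t) * f (s t) ->
  exists mu : 'I_m -> K, forall D t, D (mu t) = iota (E t) * (theta u D (s t) - theta u D i).
Proof.
move=> lpf free_s rk grad0 i E fE; have [f0 fL] := lpf.
have cancel_terms (x y z p v : K) : x - y = x + p - (y + z) + v -> v = z - p.
  move=> h; have -> : v = x + p - (y + z) + v - (x + p - (y + z)) by ring.
  by rewrite -h; ring.
have [W sW dW] := wronskian_neq0 charK free_s.
pose rv (w : word) := relation_variation rho a g q u f s i E w.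
pose A (w : word) (o : option I) : K := oapp (fun i' => apply_word w (f i')) (rv w) o.
have [|mu muE] := @det_border _ _ _ A m W (Some \o s) None.
  by move: dW; congr (\det _ != 0); apply/matrixP => p t; rewrite !mxE.
have {}muE (w : word) : (size w <= m)%N -> rv w = \sum_t apply_word w (f (s t)) * mu t.
  move=> sw; apply: (muE w); apply: etrans (esym (grad_minor W w u lpf fE)) _.
  by rewrite grad0 ?mulr0 //; apply: short_fcons.
exists mu => D t; apply/eqP; rewrite -subr_eq0; apply/eqP; move: t.
apply: (det_ker0 dW) => p; have sp : (size (W p) < m)%N.
  by apply: leq_ltn_trans (sW p); rewrite leq_addr.
have := muE (D :: W p) sp; rewrite /rv /relation_variation.
rewrite (word_variation_cons _ _ _ _ lpf).
under eq_bigr => t _ do rewrite (word_variation_cons _ _ _ _ lpf) mulrDr -derZ.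
rewrite big_split /= -raddf_sum /= => e.
have eD : D (rv (W p)) = \sum_t (D (apply_word (W p) (f (s t))) * mu t
    + apply_word (W p) (f (s t)) * D (mu t)).
  by rewrite muE 1?ltnW // raddf_sum; apply: eq_bigr => t _; rewrite /= derM.
move: eD; rewrite /rv /relation_variation raddfB big_split /= -e => eD.
have fEp : apply_word (W p) (f i) = \sum_t iota (E t) * apply_word (W p) (f (s t)).
  by rewrite fE apply_word_lin.
have : \sum_t apply_word (W p) (f (s t)) * D (mu t) =
    \sum_t iota (E t) * (apply_word (W p) (f (s t)) * theta u D (s t))
    - apply_word (W p) (f i) * theta u D i.
  exact: cancel_terms eD.
rewrite fEp mulr_suml -sumrB => /eqP; rewrite -subr_eq0 -sumrB => /eqP e'.
by rewrite -[RHS]e'; apply: eq_bigr => t _; rewrite mxE /=; ring.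
Qed.

(** Call two indices equivalent when their [theta] differ by an exact form. Every [s t] occurring in
    the relation for [f i] is equivalent to [i], so each class sums to zero. By nondegeneracy the
    class of [i0] is everything, and [theta] is 0 at [i0]. *)
Lemma theta_exact q f m (s : 'I_m -> I) u :
  log_point q f -> vanishing_sum f -> kfree iota (f \o s) -> rank_lt f m.+1 ->
  (forall W s', short_words W -> grad_along (pt u) (pt q) (@minor m.+1 W s') = 0) ->
  forall i, exists x, forall D, theta u D i = D x.
Proof.
move=> lpf [f0 fS] free_s rk grad0.
pose ex i j := exists x, forall D, theta u D i - theta u D j = D x.
have ex_refl i : ex i i by exists 0 => D; rewrite subrr raddf0.
have ex_sym i j : ex i j -> ex j i.
  by case=> x xP; exists (- x) => D; rewrite raddfN /= -xP opprB.
have ex_trans i j l : ex i j -> ex j l -> ex i l.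
  by move=> [x xP] [y yP]; exists (x + y) => D; rewrite raddfD /= -xP -yP addrA subrK.
have /choice[E fE] := kfree_span free_s rk.
have exE i t : E i t != 0 -> ex (s t) i.
  move=> Eit; have [mu muE] := exact_difference lpf free_s rk grad0 (fE i).
  have iE : iota (E i t) != 0 by rewrite fmorph_eq0.
  exists (iota (E i t)^-1 * mu t) => D.
  by rewrite derZ muE mulrA -rmorphM mulVf // rmorph1 mul1r.
pose S := [set i | `[< ex i i0 >]]%SET.
have inS i : (i \in S) = `[< ex i i0 >] by rewrite inE.
have sumE0 t : \sum_i E i t = 0.
  apply: (free_s (fun t => \sum_i E i t)); rewrite -[RHS]f0.
  under [RHS]eq_bigr => i _ do rewrite fE.
  rewrite exchange_big; apply: eq_bigr => t' _ /=.
  by rewrite rmorph_sum mulr_suml.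
have sumS : \sum_(i in S) f i = 0.
  under eq_bigr => i _ do rewrite fE.
  rewrite exchange_big big1 //= => t _; rewrite -mulr_suml -rmorph_sum.
  suff -> : \sum_(i in S) E i t = 0 by rewrite rmorph0 mul0r.
  have [st|nst] := boolP (s t \in S); last first.
    apply: big1 => i iS; apply/eqP/negPn/negP => Eit; move: nst; rewrite inS => /asboolP; apply.
    by apply: ex_trans (exE _ _ Eit) _; apply/asboolP; rewrite -inS.
  rewrite -[RHS](sumE0 t) [RHS](bigID (mem S)) /= [X in _ + X]big1 ?addr0 // => i niS.
  apply/eqP/negPn/negP => Eit; move: niS; rewrite inS => /asboolP; apply.
  apply: ex_trans (ex_sym _ _ (exE _ _ Eit)) _; apply/asboolP.
  by rewrite -inS.
have ST : S = finset.setT.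
  apply/eqP/negPn/negP => nT; have S0 : S != finset.set0.
    by apply/set0Pn; exists i0; rewrite inS; apply/asboolP; apply: ex_refl.
  by have := fS S S0 nT; rewrite sumS eqxx.
have th0 D : theta u D i0 = 0.
  by rewrite /theta big1 // => j _; rewrite g_i0 /logder der1 mul0r mulr0.
move=> i; have : i \in S by rewrite ST finset.in_setT.
by rewrite inS => /asboolP[x xP]; exists x => D; rewrite -xP th0 subr0.
Qed.

Lemma minor_gradient q f m (s : 'I_m -> I) u :
  log_point q f -> vanishing_sum f -> kfree iota (f \o s) -> rank_lt f m.+1 ->
  (exists j, u j != 0) ->
  exists W s', short_words W /\ grad_along (pt u) (pt q) (@minor m.+1 W s') != 0.
Proof.
move=> lpf vf free_s rk [j uj]; apply: contrapT => ngrad.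
have /(theta_exact lpf vf free_s rk) th_ex : forall W s', short_words W ->
    grad_along (pt u) (pt q) (@minor m.+1 W s') = 0.
  move=> W s' sW; apply/eqP/negPn/negP => gr; apply: ngrad.
  by exists W, s'.
have [d d0 [U dU]] := common_denominator u.
suff /(_ j) Uj : forall j, U j = 0.
  have /eqP := dU j; rewrite Uj mulf_eq0 (negbTE uj) intr_eq0.
  by rewrite (negbTE d0).
apply: g_indep => i; have [x xP] := th_ex i.
(* Clearing denominators turns [u] into integers [U]; the product is then an exponential of [d * x],
   hence constant. *)
have h0 : \prod_j g j i ^ U j != 0 by apply/prodf_neq0 => j' _; apply: expfz_neq0.
apply: (exp_constant charK (x := rho d%:~R * x) h0) => D.
have -> : D (rho d%:~R * x) = logder D (\prod_j g j i ^ U j).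
  rewrite derM der_rat mul0r add0r -xP /theta mulr_sumr.
  rewrite logder_prod => [|j']; last exact: expfz_neq0.
  apply: eq_bigr => j' _; rewrite logderXz // mulrA -rmorphM mulrC [_ * u _]mulrC.
  by rewrite dU rmorph_int mulrzr.
by rewrite /logder mulrC divfK.
Qed.

End Tangent.

(** * Counting cosets *)

Section RationalDescent.
Variables (K : fieldType) (rho : {rmorphism rat -> K}) (r : nat).
Implicit Types (q u : 'I_r -> rat).
Local Notation pt q := (fun j => rho (q j)).

Lemma rat_basis (s : seq K) : exists n (e : 'I_n -> K),
  (forall c : 'I_n -> rat, \sum_b rho (c b) * e b = 0 -> forall b, c b = 0) /\
  forall x, x \in s -> exists c : 'I_n -> rat, x = \sum_b rho (c b) * e b.
Proof.
elim: s => [|x s [n [e [free_e span_e]]]].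
  by exists 0%N, (fun=> 0); split=> [c _ []|].
have [[c xc]|nx] := pselect (exists c : 'I_n -> rat, x = \sum_b rho (c b) * e b).
  exists n, e; split=> // y; rewrite inE => /predU1P[->|/span_e //].
  by exists c.
exists n.+1, (fcons x e); split=> [c|y].
  rewrite big_ord_recl fcons0.
  under eq_bigr => b _ do rewrite fconsS.
  have [c0|c0] := eqVneq (c ord0) 0.
    rewrite c0 rmorph0 mul0r add0r => /(free_e (fun b => c (lift ord0 b))) cl b.
    by case: (unliftP ord0 b) => [b'|] ->.
  move=> /eqP; rewrite addr_eq0 => /eqP xE; case: nx.
  exists (fun b => - c (lift ord0 b) / c ord0).
  have rc0 : rho (c ord0) != 0 by rewrite fmorph_eq0.
  apply: (mulfI rc0); rewrite xE mulr_sumr -sumrN; apply: eq_bigr => b _.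
  by rewrite fmorph_div rmorphN; field.
rewrite inE => /predU1P[->|/span_e[c ->]].
  exists (fcons 1 (fun=> 0)); rewrite big_ord_recl !fcons0 rmorph1 mul1r.
  by rewrite big1 ?addr0 // => b _; rewrite !fconsS rmorph0 mul0r.
exists (fcons 0 c); rewrite big_ord_recl !fcons0 rmorph0 mul0r add0r.
by apply: eq_bigr => b _; rewrite !fconsS.
Qed.

Lemma meval_map_rat (p : {mpoly rat[r]}) q :
  (map_mpoly rho p).@[pt q] = rho p.@[q].
Proof.
elim/mpoly_rect_closed: p => [c|i|p1 p2 e1 e2|p1 p2 e1 e2].
- by rewrite map_mpolyC !mevalC.
- have -> : map_mpoly rho 'X_i = 'X_i by exact: map_mpolyX.
  by rewrite !mevalXU.
- by rewrite !raddfD /= e1 e2.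
- by rewrite !rmorphM /= e1 e2.
Qed.

Lemma grad_map_rat (p : {mpoly rat[r]}) q u :
  grad_along (pt u) (pt q) (map_mpoly rho p) = rho (grad_along u q p).
Proof.
rewrite /grad_along rmorph_sum; apply: eq_bigr => j _.
rewrite rmorphM -meval_map_rat /=; congr (_ * _.@[_]).
by apply/mpolyP => m; rewrite mcoeff_deriv !mcoeff_map_mpoly mcoeff_deriv raddfMn.
Qed.

(** At rational arguments the values and directional derivatives of [G] are combinations of those of
    its rational components with independent coefficients. So every component inherits the rational
    zeros, and some component has nonzero derivative. *)
Lemma rational_descent (G : {mpoly K[r]}) q u :
  grad_along (pt u) (pt q) G != 0 ->
  exists P : {mpoly rat[r]}, [/\ (msize P <= msize G)%N,
    forall q', G.@[pt q'] = 0 -> P.@[q'] = 0 & grad_along u q P != 0].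
Proof.
have [n [e [free_e span_e]]] := rat_basis [seq G@_m | m <- msupp G].
have /choice[c cE] : forall m, exists c : 'I_n -> rat,
    G@_m = \sum_b rho (c b) * e b.
  move=> m; have [mG|mG] := boolP (m \in msupp G); first by apply/span_e/map_f.
  exists (fun=> 0); rewrite memN_msupp_eq0 // big1 // => b _.
  by rewrite rmorph0 mul0r.
pose P b : {mpoly rat[r]} := \sum_(m : 'X_{1..r < msize G}) c m b *: 'X_[m].
have Pc b m : (mdeg m < msize G)%N -> (P b)@_m = c m b.
  by move=> lt; rewrite (mcoeff_mpoly (fun m => c m b) lt).
have Pc0 b m : (msize G <= mdeg m)%N -> (P b)@_m = 0.
  move=> le; rewrite raddf_sum big1 //= => m' _; rewrite mcoeffZ mcoeffX.
  case: eqP => [e'|_]; last by rewrite mulr0.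
  by have := bmdeg m'; rewrite e' ltnNge le.
have GE : G = \sum_b e b *: map_mpoly rho (P b).
  apply/mpolyP => m; rewrite raddf_sum /=.
  have [lt|le] := ltnP (mdeg m) (msize G).
    rewrite cE; apply: eq_bigr => b _.
    by rewrite mcoeffZ mcoeff_map_mpoly Pc // mulrC.
  rewrite (mcoeff_msize_le (leqnn _) le) big1 // => b _.
  by rewrite mcoeffZ mcoeff_map_mpoly (Pc0 _ _ le) raddf0 mulr0.
have GEv q' : G.@[pt q'] = \sum_b rho (P b).@[q'] * e b.
  rewrite [in LHS]GE raddf_sum; apply: eq_bigr => b _ /=.
  by rewrite mevalZ meval_map_rat mulrC.
have GEg : grad_along (pt u) (pt q) G = \sum_b rho (grad_along u q (P b)) * e b.
  under [RHS]eq_bigr => b _ do rewrite -grad_map_rat /grad_along mulr_suml.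
  rewrite exchange_big; apply: eq_bigr => j _ /=.
  have -> : G^`M(j) = \sum_b e b *: (map_mpoly rho (P b))^`M(j).
    rewrite [in LHS]GE; etransitivity; first exact: (raddf_sum (@mderiv _ _ j)).
    by apply: eq_bigr => b _; rewrite /= mderivZ.
  rewrite raddf_sum mulr_sumr; apply: eq_bigr => b _ /=.
  by rewrite mevalZ; ring.
move=> gG; have [b gb] : exists b, grad_along u q (P b) != 0.
  apply: contrapT => nb; move/eqP: gG; apply; rewrite GEg big1 // => b _.
  have [->|gb] := eqVneq (grad_along u q (P b)) 0; first by rewrite rmorph0 mul0r.
  by case: nb; exists b.
exists (P b); split=> // [|q' Gq].
  by apply: msize_leP => m /Pc0.
by apply: (free_e (fun b => (P b).@[q'])); rewrite -GEv.
Qed.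

End RationalDescent.

Section Counting.
Variables (k : closedFieldType) (K : fieldType) (iota : {rmorphism k -> K}).
Hypothesis charK : [pchar K] =i pred0.
Variables (rho : {rmorphism rat -> K}) (r : nat) (I : finType).
Variables (a : I -> K) (g : 'I_r -> I -> K) (i0 : I).
Hypothesis g_neq0 : forall j i, g j i != 0.
Hypothesis g_i0 : forall j, g j i0 = 1.
Hypothesis g_indep : forall U : 'I_r -> int,
  (forall i, constant iota (\prod_j g j i ^ U j)) -> forall j, U j = 0.

Local Notation log_point q := (@log_point k K iota rho r I a g (q 0)).
Local Notation rank_lt := (@rank_lt k K iota I).
Local Notation rank_ge f m := (exists s : 'I_m -> I, kfree iota (f \o s)).

Lemma rank_lt_mono f m m' : (m <= m')%N -> rank_lt f m -> rank_lt f m'.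
Proof.
move=> le rk s free_s; apply: (rk (s \o widen_ord le)) => c cf t.
pose c' (t' : 'I_m') := oapp c 0 (insub (val t') : option 'I_m).
have c'w t' : c' (widen_ord le t') = c t' by rewrite /c' /= valK.
rewrite -c'w; apply: free_s; rewrite -[RHS]cf.
rewrite (bigID (fun t' : 'I_m' => (t' < m)%N)) /= [X in _ + X]big1 ?addr0; last first.
  by move=> t' nt; rewrite /c' insubN // rmorph0 mul0r.
rewrite (big_ord_narrow le); apply: eq_bigr => t' _.
by rewrite c'w.
Qed.

(** The rank cannot be [n.+1]: the family would then be free, although its sum vanishes. *)
Lemma rank_exists n f : #|I| = n.+1 -> (forall i, f i != 0) -> \sum_i f i = 0 ->
  exists m, [/\ (0 < m)%N, (m <= n)%N, rank_ge f m & rank_lt f m.+1].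
Proof.
move=> cI f0 fsum; pose P m := `[< rank_ge f m >].
have P1 : P 1%N.
  apply/asboolP; exists (fun=> i0) => c; rewrite big_ord1 /= => /eqP.
  rewrite mulf_eq0 (negbTE (f0 _)) orbF fmorph_eq0 => /eqP c0 t.
  by rewrite ord1.
have Pn m : P m -> (m <= n)%N.
  case/asboolP => s free_s; rewrite leqNgt; apply/negP => ltnm.
  have s_inj : injective s.
    move=> t t' ett'; apply/eqP/negPn/negP => ne.
    have := free_s (fun b => (b == t)%:R - (b == t')%:R).
    have ne' : t' != t by rewrite eq_sym.
    rewrite (bigD1 t) //= (bigD1 t') //= big1 => [|b /andP[bt bt']]; last first.
      by rewrite (negbTE bt) (negbTE bt') subrr rmorph0 mul0r.
    rewrite !eqxx (negbTE ne) (negbTE ne') subr0 sub0r ett' rmorphN rmorph1.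
    rewrite addr0 mul1r mulN1r subrr => /(_ erefl t).
    by rewrite eqxx (negbTE ne) subr0 => /eqP; rewrite oner_eq0.
  have s_bij : bijective s by apply: inj_card_bij => //; rewrite cI card_ord.
  have sum0 : \sum_t iota 1 * (f \o s) t = 0.
    rewrite -[RHS]fsum [RHS](reindex s (onW_bij _ s_bij)) /=.
    by apply: eq_bigr => t _; rewrite rmorph1 mul1r.
  have /eqP := free_s (fun=> 1) sum0 (Ordinal (leq_ltn_trans (leq0n n) ltnm)).
  by rewrite oner_eq0.
have exP : exists m, P m by exists 1%N.
case: (ex_maxnP exP Pn) => m Pm max; exists m; split.
- exact: max.
- exact: Pn.
- exact/asboolP.
- move=> s free_s; have : P m.+1 by apply/asboolP; exists s.
  by move/max; rewrite ltnn.
Qed.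

(** [q0] takes the place of the point that may fail to be simple, so only rank at most [m] is asked
    of it. *)
Lemma rank_count m (q0 : 'rV[rat]_r) (s : seq 'rV[rat]_r) : (0 < m)%N -> uniq (q0 :: s) ->
  (forall q, q \in q0 :: s -> exists2 f, log_point q f & rank_lt f m.+1) ->
  (forall q, q \in s -> exists f,
     [/\ log_point q f, vanishing_sum f, rank_ge f m & rank_lt f m.+1]) ->
  (size (q0 :: s) <= 'C(m.+1, 2) ^ r)%N.
Proof.
move=> m0 us low full; pose pt (i : 'I_(size s).+1) := nth 0 (q0 :: s) i.
apply: (@bezout_points r _ _ _ pt) => [||i ni u u0].
- by rewrite bin_gt0 ltnS.
- move=> i j /eqP; rewrite nth_uniq // => /eqP; exact: val_inj.
have [|f [lpf vf [sg free_sg] rk]] := full (pt i).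
  by rewrite /pt; case: i ni => [[|i] lti] //= _; rewrite mem_nth.
have /rV0Pn uj := u0.
have [W [s' [sW gr]]] :=
  minor_gradient charK g_neq0 g_i0 g_indep lpf vf free_sg rk uj.
have [P [sP vP gP]] := rational_descent gr.
exists P; split=> // [|l]; first exact: leq_trans sP (msize_minor _ _ _ sW).
apply: vP; have [|f' lpf' rk'] := low (pt l); first exact: mem_nth.
exact: minor_eq0 lpf' (rk' s').
Qed.

Lemma count_points n (L : seq 'rV[rat]_r) : #|I| = n.+1 -> uniq L ->
  (forall q, q \in L -> exists2 f, log_point q f & vanishing_sum f) ->
  (size L <= (\sum_(2 <= i < n.+2) 'C(i, 2) ^ r) - n + 1)%N.
Proof.
move=> cI uL solL.
have [rk rkP] : exists rk : 'rV[rat]_r -> nat, forall q, q \in L ->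
    [/\ (0 < rk q)%N, (rk q <= n)%N & exists f, [/\ log_point q f, vanishing_sum f,
      rank_ge f (rk q) & rank_lt f (rk q).+1]].
  suff /choice[rk rkP] : forall q, exists m : nat, q \in L ->
    [/\ (0 < m)%N, (m <= n)%N & exists f, [/\ log_point q f, vanishing_sum f,
      rank_ge f m & rank_lt f m.+1]] by exists rk.
  move=> q; have [qL|nqL] := boolP (q \in L); last by exists 0%N.
  have [f lpf vf] := solL _ qL; have [f0 _] := lpf; have [fsum _] := vf.
  have [m [m0 mn gem ltm]] := rank_exists cI f0 fsum.
  by exists m => _; split=> //; exists f.
have bound m : (size [seq q <- L | (rk q <= m)%N]
    <= 1 + \sum_(1 <= l < m.+1) ('C(l.+1, 2) ^ r - 1))%N.
  elim: m => [|m IHm].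
    rewrite size_filter (eq_in_count (a2 := pred0)) ?count_pred0 // => q /rkP[rk0 _ _].
    by rewrite leqn0; apply/negbTE; rewrite -lt0n.
  set A := [seq q <- L | (rk q <= m)%N] in IHm.
  pose B := [seq q <- L | rk q == m.+1].
  have -> : size [seq q <- L | (rk q <= m.+1)%N] = (size A + size B)%N.
    rewrite /A /B !size_filter -count_predUI [X in (_ + X)%N](eq_count (a2 := pred0)).
      by rewrite count_pred0 addn0; apply: eq_count => q /=; rewrite leq_eqVlt orbC.
    by move=> q /=; apply/negbTE/negP => /andP[le /eqP e]; move: le; rewrite e ltnn.
  have C1 : (0 < 'C(m.+2, 2) ^ r)%N by rewrite expn_gt0 bin_gt0.
  have fullB q : q \in B -> exists f, [/\ log_point q f, vanishing_sum f,
      rank_ge f m.+1 & rank_lt f m.+2].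
    by rewrite mem_filter => /andP[/eqP <- /rkP[_ _]].
  have uB : uniq B by apply: filter_uniq.
  rewrite big_nat_recr //= addnA.
  (* If no solution of lower rank exists, a member of [B] serves as the further zero and uses up the
     leading 1 of the bound. Otherwise the further zero comes from [A], which gives [size B] at most
     ['C(m.+2, 2) ^ r - 1]. *)
  case eA : A IHm => [|q0 A'] IHm.
    rewrite add0n; case eB : B => [|q0 B'] //.
    have : (size (q0 :: B') <= 'C(m.+2, 2) ^ r)%N.
      apply: rank_count => //; rewrite -?eB // => q qB.
        by have [f [lpf _ _ ltf]] := fullB q qB; exists f.
      by apply: fullB; rewrite eB inE qB orbT.
    by move: C1; lia.
  have [->|B0] := posnP (size B); first by rewrite addn0 (leq_trans IHm) // leq_addr.
  have q0A : q0 \in A by rewrite eA mem_head.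
  have : (size (q0 :: B) <= 'C(m.+2, 2) ^ r)%N.
    apply: rank_count => //=.
      rewrite uB andbT; apply/negP; move: q0A; rewrite !mem_filter.
      by move=> /andP[le _] /andP[/eqP e _]; move: le; rewrite e ltnn.
    move=> q; rewrite inE => /predU1P[->|qB].
      move: q0A; rewrite mem_filter => /andP[le /rkP[_ _ [f [lpf _ _ ltf]]]].
      by exists f => //; apply: rank_lt_mono ltf; rewrite ltnS leqW.
    by have [f [lpf _ _ ltf]] := fullB q qB; exists f.
  by move: IHm => /=; lia.
have /(_ n) := bound.
rewrite (eq_in_filter (a2 := predT)) => [|q /rkP[_ -> _]//].
rewrite filter_predT => /leq_trans; apply.
rewrite addnC leq_add2r [X in (_ <= X - _)%N]big_add1 /=.
have : (\sum_(1 <= l < n.+1) ('C(l.+1, 2) ^ r - 1) + n = \sum_(1 <= l < n.+1) 'C(l.+1, 2) ^ r)%N.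
  have en : n = (\sum_(1 <= l < n.+1) 1)%N.
    by rewrite sum_nat_const_nat muln1 subSS subn0.
  rewrite [X in (_ + X)%N]en.
  rewrite -big_split /=; apply: eq_big_nat => l /andP[l1 _].
  by rewrite subnK // expn_gt0 bin_gt0 ltnS l1.
by move=> <-; rewrite addnK.
Qed.

End Counting.

(** * From the subgroup and its cosets to exponent vectors *)

Section Torus.
Variables (k : closedFieldType) (K : fieldType) (iota : {rmorphism k -> K}).
Variables (n : nat).
Implicit Types (x y : {ffun 'I_n -> K}) (Gamma : set {ffun 'I_n -> K}).

Lemma ffun_mulE x y i : (x * y) i = x i * y i.
Proof. by rewrite ffunE. Qed.

Lemma ffun_prodE (T : finType) (P : pred T) (F : T -> {ffun 'I_n -> K}) i :
  (\prod_(t | P t) F t) i = \prod_(t | P t) F t i.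
Proof.
elim/big_rec2: _ => [|t x y _ <-]; last by rewrite ffun_mulE.
by rewrite ffunE.
Qed.

Lemma ktorusP x : (forall i, constant iota (x i)) -> torus K n x -> ktorus iota n x.
Proof.
move=> xc x0; have /choice[c cx] : forall i, exists c, iota c = x i.
  by move=> i; have [c _ <-] := xc i; exists c.
exists [ffun i => c i]; last by apply/ffunP => i; rewrite !ffunE cx.
by move=> i; rewrite ffunE -(fmorph_eq0 iota) cx; apply: (x0 i).
Qed.

Lemma ktorus_logder x i (D : derivation iota) : ktorus iota n x -> logder D (x i) = 0.
Proof. by case=> xi _ <-; rewrite ffunE logderC. Qed.

Lemma constantM (x y : K) : constant iota x -> constant iota y -> constant iota (x * y).
Proof. by move=> [c _ <-] [d _ <-]; exists (c * d) => //; rewrite rmorphM. Qed.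

Lemma constantXz (x : K) (z : int) : constant iota x -> constant iota (x ^ z).
Proof. by move=> [c _ <-]; exists (c ^ z) => //; rewrite fmorphXz. Qed.

Lemma ktorus_constant x i : ktorus iota n x -> constant iota (x i).
Proof. by case=> xi _ <-; rewrite ffunE; exists (xi i). Qed.

Lemma ktorus_torus x : ktorus iota n x -> torus K n x.
Proof. by case=> xi xi0 <- i; rewrite ffunE fmorph_eq0; apply: xi0. Qed.

(** A multiplicative relation modulo constants with nonzero exponent at [j0] eliminates [g j0] after
    passing to a power. With minimality of the rank this yields independence of the generators. *)
Lemma rank_le_independent Gamma r (g : 'I_r.+1 -> {ffun 'I_n -> K}) (U : 'I_r.+1 -> int) j0 :
  Gamma `<=` torus K n -> (forall j, Gamma (g j)) ->
  (forall x, Gamma x -> exists (m : int) (z : 'I_r.+1 -> int) (xi : {ffun 'I_n -> K}),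
    [/\ 0 < m, ktorus iota n xi & tpow x m = xi * \prod_j tpow (g j) (z j)]) ->
  (forall i, constant iota (\prod_j g j i ^ U j)) -> U j0 != 0 ->
  rank_le iota Gamma r.
Proof.
move=> GT Gg gen Uc U0; exists (fun j => g (lift j0 j)) => // x Gx.
have [m [z [xi [m0 kxi xE]]]] := gen x Gx.
have g0 j i : g j i != 0 by apply: GT.
have prodXz (T : finType) (F : T -> K) (w : int) :
    (\prod_t F t) ^ w = \prod_t F t ^ w.
  by elim/big_rec2: _ => [|t y1 y2 _ <-]; [rewrite exp1rz | rewrite expfzMl].
pose e := U j0; pose l := lift j0.
(* The factor [e * e] keeps the power positive whatever the sign of [U j0]. The relation raised to
   [z j0 * e] absorbs the power of [g j0]. *)
exists (m * (e * e)), (fun j => z (l j) * (e * e) - U (l j) * (z j0 * e)).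
exists [ffun i => xi i ^ (e * e) * (\prod_j g j i ^ U j) ^ (z j0 * e)]; split.
- by rewrite mulr_gt0 // -expr2 exprn_even_gt0.
- apply: ktorusP => i; rewrite ffunE.
    by apply: constantM; apply: constantXz; [apply: ktorus_constant kxi|].
  by rewrite mulf_neq0 // expfz_neq0 //; [apply: (ktorus_torus kxi)
    | apply/prodf_neq0 => j _; apply: expfz_neq0].
apply/ffunP => i; rewrite ffunE ffun_mulE ffunE ffun_prodE.
have xiE : x i ^ m = xi i * \prod_j g j i ^ z j.
  have := congr1 (fun y : {ffun 'I_n -> K} => y i) xE; rewrite ffunE ffun_mulE ffun_prodE => ->.
  by congr (_ * _); apply: eq_bigr => j _; rewrite ffunE.
rewrite -exprz_exp xiE expfzMl -mulrA; congr (_ * _).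
rewrite !prodXz !(bigD1_ord j0) //= -mulrA; congr (_ * _).
  by rewrite !exprz_exp; congr (_ ^ _); rewrite /e; ring.
rewrite -big_split; apply: eq_bigr => j _ /=; rewrite ffunE !exprz_exp -expfzDr //.
by congr (_ ^ _); rewrite /l; ring.
Qed.

(** Taking logarithmic derivatives kills the constant factor and permits division by [m], so
    [q = z / m]. *)
Lemma rat_exponents (rho : {rmorphism rat -> K}) Gamma r (g : 'I_r -> {ffun 'I_n -> K}) x :
  Gamma `<=` torus K n -> (forall j, Gamma (g j)) -> Gamma x ->
  (exists (m : int) (z : 'I_r -> int) (xi : {ffun 'I_n -> K}),
    [/\ 0 < m, ktorus iota n xi & tpow x m = xi * \prod_j tpow (g j) (z j)]) ->
  exists q : 'rV[rat]_r, forall (D : derivation iota) i,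
    logder D (x i) = \sum_j rho (q 0 j) * logder D (g j i).
Proof.
move=> GT Gg Gx [m [z [xi [m0 kxi xE]]]].
have g0 j i : g j i != 0 by apply: GT.
have x0 i : x i != 0 by apply: GT.
exists (\row_j ((z j)%:~R / m%:~R)) => D i.
have := congr1 (fun y : {ffun 'I_n -> K} => logder D (y i)) xE.
rewrite ffunE ffun_mulE ffun_prodE logderXz // logderM; last 2 first.
- exact: (ktorus_torus kxi).
- by apply/prodf_neq0 => j _; rewrite ffunE expfz_neq0.
rewrite (ktorus_logder _ _ kxi) add0r logder_prod => [|j]; last first.
  by rewrite ffunE expfz_neq0.
have mn0 : (m%:~R : rat) != 0 by rewrite intr_eq0 lt0r_neq0.
have m0K : rho m%:~R != 0 by rewrite fmorph_eq0.
rewrite -mulrzr -(rmorph_int rho) => e; apply: (mulIf m0K); rewrite e mulr_suml.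
apply: eq_bigr => j _; rewrite ffunE logderXz // mxE mulrAC -rmorphM divfK //.
by rewrite rmorph_int mulrC mulrzr.
Qed.

Lemma same_coset x y : torus K n x -> torus K n y -> [pchar K] =i pred0 ->
  (forall (D : derivation iota) i, logder D (x i) = logder D (y i)) ->
  kcoset iota y x.
Proof.
move=> x0 y0 charK xy; exists [ffun i => x i / y i]; last first.
  by apply/ffunP => i; rewrite ffun_mulE ffunE mulrCA divff ?mulr1.
apply: ktorusP => i; rewrite ffunE; last by rewrite mulf_neq0 ?invr_eq0.
have xy0 : x i / y i != 0 by rewrite mulf_neq0 ?invr_eq0.
apply: der0_constant => // D; apply/eqP.
have : logder D (x i / y i) == 0.
  by rewrite logderM ?invr_eq0 ?logderV ?xy ?subrr.
by rewrite /logder mulf_eq0 invr_eq0 (negbTE xy0) orbF.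
Qed.

End Torus.

Theorem mainTheorem1 (k : closedFieldType) (hchar : [pchar k] =i pred0)
    (K : fieldType) (iota : {rmorphism k -> K})
    (htr : transcendental_ext iota)
    (n : nat) (hn : (2 <= n)%N)
    (a : 'I_n -> K) (ha : forall i, a i != 0)
    (Gamma : set {ffun 'I_n -> K}) (hGamma : is_subgroup Gamma)
    (hk : ktorus iota n `<=` Gamma)
    (r : nat) (hrank : has_rank iota Gamma r) (hr : (0 < r)%N) :
  exists bs : seq {ffun 'I_n -> K},
    [/\ (size bs <= (\sum_(2 <= i < n.+2) 'C(i, 2) ^ r) - n + 1)%N,
        forall b, b \in bs -> Gamma b
      & [set x | Gamma x /\ nondegenerate_solution a x] `<=`
        \bigcup_(b in [set` bs]) kcoset iota b].
Proof.
have charK : [pchar K] =i pred0 by move=> p; rewrite (fmorph_pchar iota) hchar.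
have [rho _] := ratr_rmorphism charK.
case: r hr hrank => // r _ [[_] //|[_ [g Gg gen] min]].
have [GT _ _ _] := hGamma.
have g0 j i : g j i != 0 by apply: GT.
have /choice[qx qxP] : forall x, exists q : 'rV[rat]_r.+1, Gamma x ->
    forall (D : derivation iota) i,
      logder D (x i) = \sum_j rho (q 0 j) * logder D (g j i).
  move=> x; have [Gx|nGx] := pselect (Gamma x); last by exists 0.
  by have [q qP] := rat_exponents rho GT Gg Gx (gen x Gx); exists q.
(* The equation is made homogeneous by the term -1 at index [ord0]. Every generator gets the entry 1
   there, which makes [ord0] the base index [i0]. *)
pose a' : 'I_n.+1 -> K := fcons (-1) a.
pose g' j : 'I_n.+1 -> K := fcons 1 (g j).
have g'0 j i : g' j i != 0.
  by case: (unliftP ord0 i) => [i'|] ->; rewrite /g' ?fconsS ?fcons0 ?oner_eq0.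
have g'1 j : g' j ord0 = 1 by rewrite /g' fcons0.
have indep (U : 'I_r.+1 -> int) :
    (forall i, constant iota (\prod_j g' j i ^ U j)) -> forall j, U j = 0.
  move=> Uc j0; apply/eqP/negPn/negP => U0.
  have /min : rank_le iota Gamma r.
    apply: (rank_le_independent GT Gg gen _ U0) => i.
    by have := Uc (lift ord0 i); under eq_bigr => j _ do rewrite /g' fconsS.
  by rewrite ltnn.
pose sol x := Gamma x /\ nondegenerate_solution a x.
pose f (x : {ffun 'I_n -> K}) : 'I_n.+1 -> K := fcons (-1) (fun i => a i * x i).
have f_point x : sol x -> log_point iota rho a' g' (qx x 0) (f x) /\ vanishing_sum (f x).
  move=> [Gx [xsum xnd]]; have x0 i : x i != 0 by apply: GT.
  split; first split.
  - move=> i; case: (unliftP ord0 i) => [i'|] ->; rewrite /f ?fconsS ?fcons0.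
      by rewrite mulf_neq0.
    by rewrite oppr_eq0 oner_eq0.
  - move=> D i; case: (unliftP ord0 i) => [i'|] ->; rewrite /f /a' ?fconsS ?fcons0.
      rewrite logderM // (qxP _ Gx); congr (_ + _).
      by apply: eq_bigr => j _; rewrite /g' fconsS.
    rewrite big1 ?addr0 // => j _.
    by rewrite g'1 /logder der1 mul0r mulr0.
  split.
    rewrite big_ord_recl /f fcons0; under eq_bigr => i _ do rewrite fconsS.
    by rewrite xsum addNr.
  have lift_sum (S : {set 'I_n.+1}) : ord0 \notin S ->
      \sum_(i in S) f x i = \sum_(i in [set i | lift ord0 i \in S]%SET) a i * x i.
    move=> S0; rewrite big_mkcond big_ord_recl (negbTE S0) /= add0r [RHS]big_mkcond.
    by apply: eq_bigr => i _; rewrite inE /f fconsS.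
  have fsum : \sum_i f x i = 0.
    rewrite big_ord_recl /f fcons0; under eq_bigr => i _ do rewrite fconsS.
    by rewrite xsum addNr.
  have nz (S : {set 'I_n.+1}) : ord0 \notin S -> S != finset.set0 ->
      \sum_(i in S) f x i != 0.
    move=> S0 Sn; rewrite lift_sum //; set T := [set i | _]%SET.
    have [TT|nTT] := eqVneq T finset.setT.
      rewrite TT (eq_bigl xpredT) => [|i]; last by rewrite finset.in_setT.
      by rewrite xsum oner_eq0.
    apply: xnd; last by rewrite finset.properT.
    case/finset.set0Pn: Sn => i iS; apply/finset.set0Pn.
    case: (unliftP ord0 i) iS => [i'|] -> iS; first by exists i'; rewrite inE.
    by rewrite iS in S0.
  (* A subsum containing -1 is minus the sum over the complement, which avoids [ord0]. *)
  move=> S S0 ST; have [oS|oS] := boolP (ord0 \in S); last exact: nz.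
  have : \sum_(i in ~: S) f x i != 0.
    apply: nz; first by rewrite finset.in_setC oS.
    by apply: contra ST => /eqP cS; rewrite -[S]finset.setCK cS finset.setC0.
  apply: contraNN => /eqP sS.
  move: fsum; rewrite (bigID (mem S)) /= sS add0r => e.
  by rewrite (eq_bigl (fun i => i \notin S)) ?e // => i; rewrite finset.in_setC.
have bound (bs : seq {ffun 'I_n -> K}) : uniq (map qx bs) -> (forall b, b \in bs -> sol b) ->
    (size bs <= (\sum_(2 <= i < n.+2) 'C(i, 2) ^ r.+1) - n + 1)%N.
  move=> ubs sbs; rewrite -(size_map qx).
  apply: (@count_points _ _ iota charK rho _ _ a' g' ord0 g'0 g'1 indep) => //.
    by rewrite card_ord.
  by move=> _ /mapP[b bbs ->]; have [lpb vb] := f_point b (sbs b bbs); exists (f b).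
(* No finiteness is known beforehand. The bound holds for every finite list of solutions with
   distinct vectors [qx]; in a list of maximal length each further solution repeats a vector, hence
   a coset. *)
pose P N := `[< exists bs : seq {ffun 'I_n -> K}, [/\ size bs = N, uniq (map qx bs)
  & forall b, b \in bs -> sol b] >].
have exP : exists N, P N by exists 0%N; apply/asboolP; exists [::].
have PB N : P N -> (N <= (\sum_(2 <= i < n.+2) 'C(i, 2) ^ r.+1) - n + 1)%N.
  by move=> /asboolP[bs [<- ubs sbs]]; apply: bound.
case: (ex_maxnP exP PB) => N /asboolP[bs [sN ubs sbs]] max.
exists bs; split=> [|b /sbs[]//|x solx]; first exact: bound.
have [/mapP[b bbs qxb]|nqx] := boolP (qx x \in map qx bs).
  have [[Gx _] [Gb _]] := (solx, sbs b bbs).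
  exists b => //; apply: same_coset => //; [exact: GT|exact: GT|move=> D i].
  by rewrite (qxP x Gx) (qxP b Gb) qxb.
have : P N.+1.
  apply/asboolP; exists (x :: bs); rewrite /= sN nqx; split=> // b.
  by rewrite inE => /predU1P[->|/sbs].
by move/max; rewrite ltnn.
Qed.
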